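(* Consider the single-input single-output LTI plant $$D(p)y=N(p)u,\qquad p=\tfrac{d}{dt},\quad D(p)=\sum_{i=0}^n d_ip^i,\quad N(p)=\sum_{i=0}^m n_ip^i,$$ with $D,N$ coprime with unknown coefficients, known order $n$, known relative degree $d=n-m\ge1$, and high-frequency gain equal to one ($d_n=n_m=1$), and the tracking error $$e=y-\frac{1}{D_m(p)}r,$$ where $D_m(p)=\sum_{i=0}^d d_{mi}p^i$, $d_{md}=1$, is a given Hurwitz polynomial and $r$ is a bounded real-valued reference. Let $\lambda(p)=\sum_{i=0}^{n-1}\lambda_ip^i$, $\lambda_{n-1}=1$, be a designer-chosen Hurwitz polynomial, let $$\phi=\frac{1}{\lambda(p)}\big[u,\dot u,\dots,u^{(n-2)},y,\dot y,\dots,y^{(n-2)},\lambda(p)y,\lambda(p)r\big]^\top\in\mathbb{R}^{2n},$$ and let $\theta\in\mathbb{R}^{2n}$ be the (plant-dependent) parameter vector for which $D_m(p)e=u-\theta^\top\phi$ (up to exponentially decaying terms due to initial conditions). (i) The output-feedback model reference controller, consisting of a state realization of the map $(u,y,r)\mapsto\phi=\frac{1}{\lambda(p)}\big[u,\dot u,\dots,u^{(n-2)},y,\dot y,\dots,y^{(n-2)},\lambda(p)y,\lambda(p)r\big]^\top$ together with $$u=\theta^\top\phi,$$ is not a PIRC. (ii) Let $F(p)=N_f(p)/D_f(p)$ be a strictly proper, stable filter, where $N_f,D_f$ are coprime real polynomials of degrees $n_{N_f}<n_{D_f}$ with designer-chosen (i.e. $\theta$-independent) coefficients. The filtered output-feedback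 model reference controller, consisting of a state realization of the map $(u,y,r)\mapsto\phi=\frac{1}{\lambda(p)}\big[u,\dot u,\dots,u^{(n-2)},y,\dot y,\dots,y^{(n-2)},\lambda(p)y,\lambda(p)r\big]^\top$ together with $$u=F(p)(\theta^\top\phi),$$ is a PIRC for any such filter $F$ verifying the conditions: C1. $n_{D_f}\ge n_{N_f}+d$; C2. $D_f(s)-N_f(s)$ is a stable (Hurwitz) polynomial.
   Context: Definition of PIRC (controller admitting a parameter-independent realization). Consider an LTI plant with state $x\in\mathbb{R}^n$, input $u$ and output $y$, depending on unknown constant parameters, and an LTI controller with state $\xi\in\mathbb{R}^{n_\xi}$, inputs $y$ and an external reference $r$, and output $u$, whose coefficient matrices may depend on a parameter vector $\theta$. Their feedback interconnection has a closed-loop transfer function $P_{cl}(s,\theta)$ from $r$ to $y$, i.e. $Y(s)=P_{cl}(s,\theta)R(s)$. The controller is a PIRC if there exists a partial change of coordinates $$\chi=T(\theta)\begin{bmatrix}x\\ \xi\end{bmatrix},\qquad T(\theta)\in\mathbb{R}^{n_\xi\times(n+n_\xi)}$$ (so that $(x,\xi)\mapsto(x,\chi)$ is invertible), such that: (1) the controller in the coordinates $\chi$ is independent of $\theta$: along the closed-loop system, $\dot\chi=\hat A\chi+\hat B\begin{bmatrix}y\\ r\end{bmatrix}$ and $u=\hat C\chi+\hat D\begin{bmatrix}y\\ r\end{bmatrix}$ with matrices $\hat A,\hat B,\hat C,\hat D$ that do not depend on $\theta$ (so that $u$ can be generated from $y$ and $r$ without knowledge of $\theta$ and without signal differentiation);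 (2) the closed-loop transfer function $P_{cl}(s,\theta)$ remains invariant. ''Independent of $\theta$'' means the same matrices serve for all plants in the class considered (that is, for all coprime $D,N$ with the given $n$, $d$ and unit high-frequency gain). In this setting $x$ is the state of a minimal realization of the plant $D(p)y=N(p)u$, and $\xi$ collects the states of the ($\theta$-independent) realization of the map generating $\phi$ and, in the filtered case, of a $\theta$-independent realization of $F$ of order $n_{D_f}$. Exponentially decaying additive terms due to initial conditions are omitted throughout (i.e. identities, including those in (1), are understood modulo such terms). Known fact (direct control model reference parameterization): for every plant $D(p)y=N(p)u$ with $D(p)=\sum_{i=0}^n d_ip^i$ and $N(p)=\sum_{i=0}^m n_ip^i$ coprime, relative degree $d=n-m\ge1$ and $d_n=n_m=1$, there exists $\theta\in\mathbb{R}^{2n}$ such that $D_m(p)e=u-\theta^\top\phi+\epsilon_t$, where $e=y-\frac{1}{D_m(p)}r$ with $D_m(p)=\sum_{i=0}^d d_{mi}p^i$, $d_{md}=1$, Hurwitz, where $\phi=\frac{1}{\lambda(p)}\big[u,\dot u,\dots,u^{(n-2)},y,\dot y,\dots,y^{(n-2)},\lambda(p)y,\lambda(p)r\big]^\top$ with $\lambda(p)=\sum_{i=0}^{n-1}\lambda_ip^i$, $\lambda_{n-1}=1$, Hurwitz, and where $\epsilon_t$ is an exponentially decaying term due to initial conditions. For $n=1$ one has $\lambda=1$ and $\phi=[y,r]^\top$. *)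

(* Defs.v *)
From HB Require Import structures.
From mathcomp Require Import all_boot all_order all_algebra.
From mathcomp Require Import complex.
From mathcomp Require Import all_classical all_reals all_analysis.
Set Implicit Arguments.
Unset Strict Implicit.
Unset Printing Implicit Defensive.
Import Order.TTheory GRing.Theory Num.Theory.
Import numFieldNormedType.Exports.
Local Open Scope ring_scope.

Notation "p %:F" := (FracField.tofrac p) : ring_scope.

(* Nonzero constants are Hurwitz; this covers lambda = 1 when n = 1. *)
Definition hurwitz (R : realType) (p : {poly R}) : Prop :=
  forall z : R[i], root (map_poly (real_complex R) p) z -> complex.Re z < 0.

(* Transfer functions live in R(s), the fraction field of R[s] with s = 'X. *)
Definition rcst (R : realType) (a : R) : {fraction {poly R}} := (a%:P)%:F.

Definition transfer (R : realType) (q m p : nat) (A : 'M[R]_q)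
    (B : 'M[R]_(q, m)) (C : 'M[R]_(p, q)) (D : 'M[R]_(p, m)) :
    'M[{fraction {poly R}}]_(p, m) :=
  map_mx (@rcst R) C *m invmx (map_mx (@FracField.tofrac {poly R}) (char_poly_mx A))
    *m map_mx (@rcst R) B + map_mx (@rcst R) D.

(* x' = A x + B u, y = C x; used both for the plant and for the filter F. *)
Record siso (R : realType) (q : nat) := Siso {
  sisoA : 'M[R]_q;
  sisoB : 'cV[R]_q;
  sisoC : 'rV[R]_q }.

Definition siso_tf (R : realType) (q : nat) (S : siso R q) :
    {fraction {poly R}} :=
  transfer (sisoA S) (sisoB S) (sisoC S) 0 0 0.

Definition minimal (R : realType) (q : nat) (S : siso R q) : Prop :=
  forall (q' : nat) (S' : siso R q'), siso_tf S' = siso_tf S -> (q <= q')%N.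

(* xi' = A xi + B [y; r], u = C xi + D [y; r]. *)
Record controller (R : realType) (q : nat) := Controller {
  ctrA : 'M[R]_q;
  ctrB : 'M[R]_(q, 2);
  ctrC : 'rV[R]_q;
  ctrD : 'rV[R]_2 }.

Definition ctr_tf (R : realType) (q : nat) (K : controller R q) :
    'rV[{fraction {poly R}}]_2 :=
  transfer (ctrA K) (ctrB K) (ctrC K) (ctrD K).

(* The solution Y = G * R of the loop equations Y = P U, U = K_y Y + K_r R.
   The denominator is never 0, since P is strictly proper and K_y proper. *)
Definition closed_loop_tf (R : realType) (n q : nat) (P : siso R n)
    (K : controller R q) : {fraction {poly R}} :=
  siso_tf P * ctr_tf K 0 1 / (1 - siso_tf P * ctr_tf K 0 0).

Definition col2 (T : Type) (a b : T) : 'cV[T]_2 :=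
  \col_(i < 2) (if i == 0 then a else b).

Definition exp_decay (R : realType) (f : R -> R) : Prop :=
  exists c a : R, 0 < a /\ forall t, 0 <= t -> `|f t| <= c * expR (- a * t).

Definition bounded_signal (R : realType) (f : R -> R) : Prop :=
  exists M : R, forall t, 0 <= t -> `|f t| <= M.

(* x' = v on [0, +oo[, componentwise. *)
Definition has_velocity (R : realType) (q : nat) (x v : R -> 'cV[R]_q) : Prop :=
  forall (t : R) (i : 'I_q), 0 <= t ->
    is_derive t (1 : R) (fun s => x s i 0) (v t i 0).

Definition closed_loop_trajectory (R : realType) (n q : nat) (P : siso R n)
    (K : controller R q) (x : R -> 'cV[R]_n) (xi : R -> 'cV[R]_q)
    (r u y : R -> R) : Prop :=
  [/\ has_velocity x (fun t => sisoA P *m x t + u t *: sisoB P),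
      forall t, 0 <= t -> y t = (sisoC P *m x t) 0 0,
      has_velocity xi
        (fun t => ctrA K *m xi t + ctrB K *m col2 (y t) (r t)) &
      forall t, 0 <= t ->
        u t = (ctrC K *m xi t + ctrD K *m col2 (y t) (r t)) 0 0].

(* [cls P theta]: P is a state realization, in some coordinates x, of a plant of
   the class, and theta is the parameter vector of that plant.  The controller
   [Khat] is chosen before the plant, whereas T may depend on theta and on the
   coordinates x.  Residuals are required to decay for every initial state and
   every bounded r, so they can only be caused by initial conditions. *)
Definition PIRC (R : realType) (n k q : nat)
    (cls : siso R n -> 'cV[R]_k -> Prop)
    (K : 'cV[R]_k -> controller R q) : Prop :=
  exists Khat : controller R q,
  forall (P : siso R n) (theta : 'cV[R]_k), cls P theta ->
  exists T : 'M[R]_(q, n + q),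
  [/\ col_mx (row_mx 1%:M 0) T \in unitmx,
      forall (x : R -> 'cV[R]_n) (xi : R -> 'cV[R]_q) (r u y : R -> R),
        bounded_signal r ->
        closed_loop_trajectory P (K theta) x xi r u y ->
        let chi t := T *m col_mx (x t) (xi t) in
        (forall i : 'I_q, exp_decay (fun t =>
           derive1 (fun s => chi s i 0) t
           - (ctrA Khat *m chi t + ctrB Khat *m col2 (y t) (r t)) i 0)) /\
        exp_decay (fun t =>
          u t - (ctrC Khat *m chi t + ctrD Khat *m col2 (y t) (r t)) 0 0) &
      closed_loop_tf P (K theta) = closed_loop_tf P Khat].

Definition plant_polys (R : realType) (n d : nat) (D N : {poly R}) : Prop :=
  [/\ coprimep D N, D \is monic, N \is monic,
      size D = n.+1 & size N = (n - d).+1].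

(* The columns are indexed by the inputs u, y, r. *)
Definition phi_num (R : realType) (n : nat) (lam : {poly R}) :
    'M[{poly R}]_(2 * n, 1 + 2) :=
  \matrix_(i < 2 * n, j < 1 + 2)
    if (i < n.-1)%N then (if (j == 0 :> nat)%N then 'X^i else 0)
    else if (i < 2 * n.-1)%N then
      (if (j == 1 :> nat)%N then 'X^(i - n.-1) else 0)
    else if (i == 2 * n.-1 :> nat)%N then
      (if (j == 1 :> nat)%N then lam else 0)
    else (if (j == 2 :> nat)%N then lam else 0).

Definition phi_tf (R : realType) (n : nat) (lam : {poly R}) :
    'M[{fraction {poly R}}]_(2 * n, 1 + 2) :=
  map_mx (fun f => f%:F / lam%:F) (phi_num n lam).

(* D_m e = u - theta^T phi in transform domain, for zero initial conditions. *)
Definition plant_parameter (R : realType) (n : nat) (D N Dm lam : {poly R})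
    (theta : 'cV[R]_(2 * n)) : Prop :=
  forall U Rf : {fraction {poly R}},
    let Y := N%:F / D%:F * U in
    let E := Y - Rf / Dm%:F in
    let Phi := phi_tf n lam *m col_mx U%:M (col2 Y Rf) in
    Dm%:F * E = U - ((map_mx (@rcst R) theta)^T *m Phi) 0 0.

Definition plant_class (R : realType) (n d : nat) (Dm lam : {poly R})
    (P : siso R n) (theta : 'cV[R]_(2 * n)) : Prop :=
  exists D N : {poly R},
  [/\ plant_polys n d D N, siso_tf P = N%:F / D%:F, minimal P &
      plant_parameter D N Dm lam theta].

(* xi' = A xi + Bu u + B [y; r], phi = C xi + D [y; r].  There is no feedthrough
   from u, since phi depends on u in a strictly proper way. *)
Record phi_filter (R : realType) (n q : nat) := PhiFilter {
  phiA : 'M[R]_q;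
  phiBu : 'cV[R]_q;
  phiB : 'M[R]_(q, 2);
  phiC : 'M[R]_(2 * n, q);
  phiD : 'M[R]_(2 * n, 2) }.

Definition realizes_phi (R : realType) (n q : nat) (lam : {poly R})
    (G : phi_filter R n q) : Prop :=
  transfer (phiA G) (row_mx (phiBu G) (phiB G)) (phiC G) (row_mx 0 (phiD G))
  = phi_tf n lam.

(* Modes that are not modes of 1/lambda are not visible in the transfer
   function; they have to decay for the output to be phi up to decaying terms.
   A minimal realization has no such mode. *)
Definition hidden_modes_decay (R : realType) (n q : nat) (lam : {poly R})
    (G : phi_filter R n q) : Prop :=
  forall z : R[i],
    root (map_poly (real_complex R) (char_poly (phiA G))) z ->
    root (map_poly (real_complex R) lam) z \/ complex.Re z < 0.

(* u = theta^T phi, with u eliminated from the filter equation. *)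
Definition mrc (R : realType) (n q : nat) (G : phi_filter R n q)
    (theta : 'cV[R]_(2 * n)) : controller R q :=
  Controller (phiA G + phiBu G *m (theta^T *m phiC G))
             (phiB G + phiBu G *m (theta^T *m phiD G))
             (theta^T *m phiC G)
             (theta^T *m phiD G).

(* u = F(p) (theta^T phi), with state (xi, z):
     xi' = A xi + Bu u + B [y; r],   z' = A_F z + B_F (theta^T phi),
     u = C_F z. *)
Definition filtered_mrc (R : realType) (n q l : nat) (G : phi_filter R n q)
    (F : siso R l) (theta : 'cV[R]_(2 * n)) : controller R (q + l) :=
  Controller
    (block_mx (phiA G) (phiBu G *m sisoC F)
              (sisoB F *m (theta^T *m phiC G)) (sisoA F))
    (col_mx (phiB G) (sisoB F *m (theta^T *m phiD G)))
    (row_mx 0 (sisoC F))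
    0.

(* Main.v *)
Require Import Defs.
From HB Require Import structures.
From mathcomp Require Import all_boot all_order all_algebra.
From mathcomp Require Import complex.
From mathcomp Require Import all_classical all_reals all_analysis.
From mathcomp Require Import ring lra zify.
Set Implicit Arguments.
Unset Strict Implicit.
Unset Printing Implicit Defensive.
Import Order.TTheory GRing.Theory Num.Theory.
Import numFieldNormedType.Exports.
Local Open Scope ring_scope.

(** Let P = N/D be the plant.  Eliminating y and e, the matching equation
    Dm e = u - theta^T phi says Dm P = 1 - alpha - beta P, where alpha and beta
    are the transfer functions from u and from y to theta^T phi, and that the one
    from r to theta^T phi is 1 ([plant_identity]).

    (i) With u = theta^T phi the closed loop is therefore 1/Dm, for every plant of
    the class ([closed_loop_mrc]).  A controller (K_y, K_r) that does not depend
    on the plant and has this closed loop satisfies 1/P = K_y + Dm K_r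
    ([loop_tf_inv]).  The right-hand side does not depend on P, but the class
    contains the distinct plants s^(n-d) / (s^n + c), c <> 0 ([plant_exists];
    their parameter theta comes from the Euclidean division of lam Dm by D).

    (ii) Up to the equation error eps = theta^T phi - (u - Dm y + r), the law
    u = F (theta^T phi) reads u = F (u - Dm y + r), where theta has disappeared.
    In state space, F becomes z' = A0 z + B_F (r - Dm(p) y) with the feedback
    A0 = A_F + B_F C_F.  The derivatives y^(j) of order j < d are linear
    functions C_P A_P^j x of the plant state, and y^(d) is such a function plus u,
    the gain being one.  They are absorbed in the new state
    chi = z + sum_j b_j y^(j), where the b_j are obtained from Dm by Horner's
    rule in A0 and applied to B_F.  The sum is a solution E x of a Sylvester
    equation ([mxdiffP]), and what is left is
    chi' = A0 chi + B_F r - Dm(A0) B_F y + B_F eps ([pirc_residual]).  The output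
    u = C_F z is C_F chi minus a multiple of y, because C_F b_j = 0 for j > 0:
    this is where F needs relative degree at least d.

    It remains to see that eps decays although the plant may be unstable
    ([equation_error_decay]).  Its transfer functions from u and r vanish, so eps
    only sees uncontrollable modes of the system made of the plant and the filter
    phi.  The plant is controllable, since D and N are coprime and its order is
    the degree of D ([controllable]); hence these modes are modes of the filter,
    and g(d/dt) eps = 0 for the characteristic polynomial g of the filter
    ([unobservable_poly]).  As g is Hurwitz, eps decays ([hurwitz_decay]).

    The transfer functions agree by the same computation with d/dt replaced by s
    ([pirc_controller_tf], [closed_loop_tfE]). *)

(** * Polynomials in a matrix *)

Section MxEval.
Variable R : comNzRingType.

(** Unlike [horner_mx], this covers n = 0: a filter phi may have no state. *)
Definition mxeval n (A : 'M[R]_n) (p : {poly R}) : 'M[R]_n :=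
  \sum_(i < size p) p`_i *: A ^+ i.

Lemma mxeval_widen n (A : 'M[R]_n) (p : {poly R}) N : (size p <= N)%N ->
  mxeval A p = \sum_(i < N) p`_i *: A ^+ i.
Proof.
move=> le_pN; rewrite /mxeval (big_ord_widen N (fun i => p`_i *: A ^+ i)) //.
rewrite big_mkcond; apply: eq_bigr => i _ /=; case: ltnP => // le_pi.
by rewrite nth_default // scale0r.
Qed.

Lemma mxeval_horner n (A : 'M[R]_n.+1) p : mxeval A p = horner_mx A p.
Proof.
rewrite -[in RHS](coefK p) poly_def rmorph_sum /=.
by apply: eq_bigr => i _; rewrite linearZ /= rmorphXn /= horner_mx_X.
Qed.

Lemma mxeval_char_poly n (A : 'M[R]_n) : mxeval A (char_poly A) = 0.
Proof.
case: n A => [|n] A; first by apply/matrixP=> -[].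
by rewrite mxeval_horner Cayley_Hamilton.
Qed.

Lemma mxpow_intertwine m n (A : 'M[R]_m) (B : 'M[R]_n) (M : 'M[R]_(m, n)) k :
  A *m M = M *m B -> A ^+ k *m M = M *m B ^+ k.
Proof.
move=> AM; elim: k => [|k IHk]; first by rewrite !expr0 mul1mx mulmx1.
rewrite exprS exprSr -!mulmxE -mulmxA IHk mulmxA AM -mulmxA.
by congr (_ *m _); rewrite !mulmxE -exprS exprSr.
Qed.

Lemma mxeval_intertwine m n (A : 'M[R]_m) (B : 'M[R]_n) (M : 'M[R]_(m, n)) p :
  A *m M = M *m B -> mxeval A p *m M = M *m mxeval B p.
Proof.
move=> AM; rewrite mulmx_suml mulmx_sumr; apply: eq_bigr => i _.
by rewrite -scalemxAl -scalemxAr (mxpow_intertwine _ AM).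
Qed.

(** Horner's rule: [drop_poly j p] is the quotient of p by 'X^j. *)
Lemma mxeval_drop n (A : 'M[R]_n) (p : {poly R}) j :
  mxeval A (drop_poly j p) = (p`_j)%:M + A *m mxeval A (drop_poly j.+1 p).
Proof.
have le_j: (size (drop_poly j.+1 p) <= size p)%N.
  by rewrite size_drop_poly leq_subr.
rewrite (@mxeval_widen _ _ (drop_poly j p) (size p).+1); last first.
  by rewrite size_drop_poly -addn1 (leq_trans (leq_subr _ _)) ?leq_addr.
rewrite big_ord_recl coef_drop_poly add0n expr0 scalemx1; congr (_ + _).
rewrite (mxeval_widen _ le_j) mulmx_sumr; apply: eq_bigr => i _.
by rewrite !coef_drop_poly addSnnS -scalemxAr exprS mulmxE.
Qed.

(** The divided difference (p(A) - p(B)) / (A - B), with M inserted between the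
    powers of A and those of B. *)
Definition mxdiff m n (A : 'M[R]_m) (B : 'M[R]_n) (M : 'M[R]_(m, n)) (p : {poly R}) :=
  \sum_(j < size p) mxeval A (drop_poly j.+1 p) *m M *m B ^+ j.

(** By Horner's rule A times the j-th term is the previous one times B, up to the
    term of index j in M p(B), so the sum telescopes. *)
Lemma mxdiffP m n (A : 'M[R]_m) (B : 'M[R]_n) (M : 'M[R]_(m, n)) p :
  A *m mxdiff A B M p + M *m mxeval B p
  = mxdiff A B M p *m B + mxeval A p *m M.
Proof.
rewrite /mxdiff mulmx_suml !mulmx_sumr -big_split /=.
pose G j := mxeval A (drop_poly j p) *m M *m B ^+ j.
transitivity (\sum_(j < size p) G j).
  apply: eq_bigr => j _; rewrite /G [in RHS]mxeval_drop !mulmxDl addrC.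
  by rewrite mul_scalar_mx -scalemxAl -scalemxAr !mulmxA.
have -> : \sum_(j < size p) G j = \sum_(j < (size p).+1) G j.
  rewrite big_ord_recr /= [G (size p)]/G drop_poly_eq0 //.
  by rewrite /mxeval size_poly0 big_ord0 !mul0mx addr0.
rewrite big_ord_recl addrC /G drop_poly0l expr0 mulmx1; congr (_ + _).
by apply: eq_bigr => j _; rewrite exprSr -mulmxE !mulmxA.
Qed.
End MxEval.

Lemma mx11_eq (R : comNzRingType) (M : 'M[R]_1) a : M 0 0 = a -> M = a%:M.
Proof. by move=> <-; exact: mx11_scalar. Qed.

Section MarkovSum.
Variables (R : comNzRingType) (q k : nat) (A : 'M[R]_q) (B : 'cV[R]_q) (C : 'rV[R]_q).
Hypothesis CAB : forall i, (i < k)%N -> C *m A ^+ i *m B = 0.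

(** The scalars C A^i B are the Markov parameters; when the first k of them
    vanish, a polynomial of degree at most k only sees the next one. *)
Lemma mxeval_markov (p : {poly R}) : (size p <= k.+1)%N ->
  C *m mxeval A p *m B = p`_k *: (C *m A ^+ k *m B).
Proof.
move=> sp; rewrite (mxeval_widen _ sp) mulmx_sumr mulmx_suml big_ord_recr /=.
rewrite big1 ?add0r => [|i _]; first by rewrite -scalemxAr -scalemxAl.
by rewrite -scalemxAr -scalemxAl CAB ?scaler0.
Qed.

Lemma mxeval_drop_markov (p : {poly R}) j : (size p <= k.+2)%N ->
  C *m mxeval A (drop_poly j.+2 p) *m B = 0.
Proof.
move=> sp; have sd : (size (drop_poly j.+2 p) <= k)%N.
  by rewrite size_drop_poly; lia.
by rewrite mxeval_markov ?(leq_trans sd) // nth_default ?scale0r.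
Qed.

Lemma mxdiff_markov m (A' : 'M[R]_m) (C' : 'rV[R]_m) (p : {poly R}) :
  (size p <= k.+2)%N -> (0 < size p)%N ->
  C *m mxdiff A A' (B *m C') p = C *m mxeval A (drop_poly 1 p) *m B *m C'.
Proof.
move=> sp p0; rewrite /mxdiff mulmx_sumr.
rewrite -(big_mkord xpredT (fun j =>
  C *m (mxeval A (drop_poly j.+1 p) *m (B *m C') *m A' ^+ j))).
rewrite big_ltn //= expr0 mulmx1 !mulmxA big_nat_cond big1 ?addr0 // => i.
rewrite andbT => /andP[i0 _]; rewrite -(prednK i0) !mulmxA.
by rewrite mxeval_drop_markov // !mul0mx.
Qed.

(** An output feedback first acts on the output through C B, so it cannot change
    the powers of A seen by C before the first nonzero Markov parameter. *)
Lemma feedback_pow i : (i <= k)%N -> C *m (A + B *m C) ^+ i = C *m A ^+ i.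
Proof.
elim: i => [|i IHi] ik; first by rewrite !expr0.
rewrite !exprSr -!mulmxE !mulmxA IHi ?(ltnW ik) // mulmxDr mulmxA CAB //.
by rewrite mul0mx addr0.
Qed.
End MarkovSum.

(** The row V = L g(Ae), with g the characteristic polynomial of A, kills the
    states (0, xi) by Cayley-Hamilton, so V factors through the state of the pair
    (AP, BP).  It also kills the reachable states, whose first components are all
    of the state space of this controllable pair.  Hence V = 0. *)
Lemma unobservable_poly (R : comNzRingType) (n q : nat) (AP : 'M[R]_n) (BP : 'cV[R]_n)
    (S : 'M[R]_(q, n)) (A : 'M[R]_q) (Bu : 'cV[R]_q) (L : 'rV[R]_(n + q))
    (Ae := block_mx AP 0 S A) :
  (forall W : 'rV[R]_n, (forall k, (W *m AP ^+ k *m BP) 0 0 = 0) -> W = 0) ->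
  (forall k, (L *m Ae ^+ k *m col_mx BP Bu) 0 0 = 0) ->
  L *m mxeval Ae (char_poly A) = 0.
Proof.
move=> ctrb LAB; set g := char_poly A.
have right0 : L *m mxeval Ae g *m col_mx 0 1%:M = 0.
  rewrite -mulmxA (@mxeval_intertwine _ _ _ _ A) ?mxeval_char_poly ?mulmx0 //.
  by rewrite /Ae mul_block_col mul_col_mx !mulmx0 !mul0mx !mul1mx mulmx1 !add0r.
have E : L *m mxeval Ae g = L *m mxeval Ae g *m col_mx 1%:M 0 *m row_mx 1%:M 0.
  have := mulmx1 (L *m mxeval Ae g).
  have -> : 1%:M = col_mx 1%:M 0 *m row_mx 1%:M 0
      + col_mx 0 1%:M *m row_mx 0 1%:M :> 'M[R]_(n + q).
    rewrite !mul_col_row !mulmx1 !mulmx0 add_block_mx !addr0 !add0r.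
    exact: scalar_mx_block.
  by rewrite mulmxDr !mulmxA right0 mul0mx addr0 => {1}<-.
(* W is the restriction of L g(Ae) to the states (x, 0). *)
rewrite E; set W := _ *m col_mx _ _ in E *.
suff -> : W = 0 by rewrite mul0mx.
apply: ctrb => k.
have -> : W *m AP ^+ k *m BP = L *m mxeval Ae g *m Ae ^+ k *m col_mx BP Bu.
  have {1}-> : BP = row_mx 1%:M 0 *m col_mx BP Bu.
    by rewrite mul_row_col mul1mx mul0mx addr0.
  rewrite mulmxA -[W *m _ *m _]mulmxA (@mxpow_intertwine _ _ _ _ Ae).
    by rewrite mulmxA -E.
  by rewrite /Ae mul_row_block mul_mx_row !mul1mx !mul0mx !mulmx0 mulmx1 !addr0.
rewrite /mxeval mulmx_sumr !mulmx_suml summxE big1 // => i _.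
by rewrite -scalemxAr -!scalemxAl -[L *m _ *m _]mulmxA mulmxE -exprD mxE LAB mulr0.
Qed.

(** * Exponential decay of the solutions of a Hurwitz equation *)

Section Decay.
Variable R : realType.
Implicit Types (f g V : R -> R).

Lemma le_init_of_derive_le0 (f f' : R -> R) :
  (forall t : R, 0 <= t -> is_derive t (1 : R) f (f' t)) ->
  (forall t : R, 0 <= t -> f' t <= 0) ->
  forall t : R, 0 <= t -> f t <= f 0.
Proof.
move=> df le0 t t0.
have d x : x \in `[0, t] -> derivable f x 1.
  by rewrite in_itv /= => /andP[x0 _]; have [] := df x x0.
apply: (@ler0_derive1_le_cc R f 0 t) => //.
- move=> x; rewrite in_itv /= => /andP[/ltW x0 /ltW xt].
  by apply: d; rewrite in_itv /= x0.
- move=> x; rewrite in_itv /= => /andP[/ltW x0 _].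
  by rewrite derive1E; have [_ ->] := df x x0; exact: le0.
- exact: derivable_within_continuous d.
- by rewrite in_itv /= t0 lexx.
- by rewrite in_itv /= lexx t0.
Qed.

Lemma is_derive_expRM (k t : R) :
  is_derive t (1 : R) (fun t => expR (k * t)) (k * expR (k * t)).
Proof.
have dk : is_derive t (1 : R) (fun t : R => k * t) k.
  have := is_deriveZ k (is_derive_id t (1 : R)).
  by rewrite [k *: _]mulr1.
rewrite mulrC; exact: (is_derive1_comp (is_derive_expR (k * t)) dk).
Qed.

(** A comparison argument: for a <= k and a < c, the function
    V e^(at) + C/(c-a) e^(-(c-a)t) has nonpositive derivative. *)
Lemma decay_of_derive_le V (V' : R -> R) (k c C : R) :
  0 < k -> 0 < c -> 0 <= C -> (forall t : R, 0 <= t -> 0 <= V t) ->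
  (forall t : R, 0 <= t -> is_derive t (1 : R) V (V' t)) ->
  (forall t : R, 0 <= t -> V' t <= - k * V t + C * expR (- c * t)) ->
  exp_decay V.
Proof.
move=> k0 c0 C0 V0 dV leV.
pose a := Num.min k (c / 2).
have a0 : 0 < a by rewrite lt_min k0 divr_gt0.
have ak : a <= k by rewrite ge_min lexx.
have ac : 0 < c - a.
  by rewrite subr_gt0 (@le_lt_trans _ _ (c / 2)) ?ge_min ?lexx ?orbT //; lra.
pose b := c - a.
pose Phi t := V t * expR (a * t) + C / b * expR (- b * t).
have dPhi (t : R) : 0 <= t -> is_derive t (1 : R) Phi
    (V t * (a * expR (a * t)) + expR (a * t) * V' t + C / b * (- b * expR (- b * t))).
  move=> t0; have d1 := dV t t0; have d2 := is_derive_expRM a t.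
  have d3 := is_derive_expRM (- b) t.
  have d12 := is_deriveM d1 d2.
  exact: is_deriveD d12 (@is_deriveZ _ _ _ _ (C / b) _ _ _ d3).
have lePhi (t : R) : 0 <= t -> Phi t <= Phi 0.
  move=> t0; apply: (le_init_of_derive_le0 dPhi) => // {}t {}t0.
  have -> : C / b * (- b * expR (- b * t)) = - (C * expR (- c * t) * expR (a * t)).
    have -> : - b * t = - c * t + a * t by rewrite /b; ring.
    by rewrite expRD; field; rewrite gt_eqF.
  rewrite -subr_le0 subr0.
  have := leV t t0; have := V0 t t0.
  have E0 := expR_gt0 (a * t); set E := expR (a * t) in E0 *.
  set h := C * _ => Vt V't.
  have -> : V t * (a * E) + E * V' t - h * E = E * (a * V t + V' t - h) by ring.
  rewrite pmulr_rle0 //; nra.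
exists (Phi 0), a; split=> // t t0; rewrite ger0_norm ?V0 //.
rewrite mulNr expRN ler_pdivlMr ?expR_gt0 //.
apply: le_trans (lePhi t t0); rewrite lerDl mulr_ge0 ?expR_ge0 //.
by rewrite divr_ge0 // ltW.
Qed.

Lemma exp_decay_sqr f g : (forall t : R, 0 <= t -> f t ^+ 2 <= g t) ->
  exp_decay g -> exp_decay f.
Proof.
move=> fg [c [a [a0 le_g]]].
exists (Num.sqrt c), (a / 2); split=> [|t t0]; first by rewrite divr_gt0.
have c0 : 0 <= c.
  have := le_trans (normr_ge0 _) (le_g 0 (lexx _)).
  by rewrite mulr0 expR0 mulr1.
rewrite -sqrtr_sqr.
have -> : expR (- (a / 2) * t) = Num.sqrt (expR (- a * t)).
  have -> : - a * t = - (a / 2) * t + - (a / 2) * t by field.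
  by rewrite expRD -expr2 sqrtr_sqr ger0_norm ?expR_ge0.
rewrite -sqrtrM // ler_wsqrtr // (le_trans (fg t t0)) //.
exact: le_trans (ler_norm _) (le_g t t0).
Qed.

Lemma exp_decay_sqr_bound f g : exp_decay f -> exp_decay g ->
  exists C c : R, [/\ 0 <= C, 0 < c &
    forall t : R, 0 <= t -> f t ^+ 2 + g t ^+ 2 <= C * expR (- c * t)].
Proof.
move=> [c1 [a1 [a10 H1]]] [c2 [a2 [a20 H2]]].
pose a := Num.min a1 a2.
have a0 : 0 < a by rewrite lt_min a10.
have aux (h : R -> R) (c' a' : R) :
    (forall t : R, 0 <= t -> `|h t| <= c' * expR (- a' * t)) -> a <= a' ->
    forall t : R, 0 <= t -> h t ^+ 2 <= c' ^+ 2 * expR (- a * t).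
  move=> hh aa' t t0; rewrite -(real_normK (num_real (h t))).
  apply: (@le_trans _ _ ((c' * expR (- a' * t)) ^+ 2)).
    by rewrite ler_sqr ?nnegrE ?hh // (le_trans _ (hh t t0)).
  rewrite exprMn ler_wpM2l ?sqr_ge0 // expr2 -expRD ler_expR.
  by nra.
exists (c1 ^+ 2 + c2 ^+ 2), a; split=> //; first by rewrite addr_ge0 ?sqr_ge0.
move=> t t0; rewrite mulrDl lerD //.
  by apply: aux H1 _ t t0; rewrite ge_min lexx.
by apply: aux H2 _ t t0; rewrite ge_min lexx orbT.
Qed.

(** The complex equation w' = z w + h with z = a + i b, in real coordinates.  The
    derivative of |w|^2 is 2 a |w|^2 + 2 Re(conj(w) h), at most
    a |w|^2 + |h|^2 / (-a). *)
Lemma planar_decay (a b : R) (w1 w2 h1 h2 : R -> R) :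
  a < 0 -> exp_decay h1 -> exp_decay h2 ->
  (forall t : R, 0 <= t -> is_derive t (1 : R) w1 (a * w1 t - b * w2 t + h1 t)) ->
  (forall t : R, 0 <= t -> is_derive t (1 : R) w2 (a * w2 t + b * w1 t + h2 t)) ->
  exp_decay w1 /\ exp_decay w2.
Proof.
move=> a0 dh1 dh2 dw1 dw2.
have [C [c [C0 c0 leh]]] := exp_decay_sqr_bound dh1 dh2.
have na0 : 0 < - a by rewrite oppr_gt0.
pose V t := w1 t ^+ 2 + w2 t ^+ 2.
suff decV : exp_decay V.
  by split; apply: exp_decay_sqr decV => t _; rewrite /V ?lerDl ?lerDr sqr_ge0.
pose v1 t := a * w1 t - b * w2 t + h1 t; pose v2 t := a * w2 t + b * w1 t + h2 t.
pose V' t := (w1 t * v1 t + w1 t * v1 t) + (w2 t * v2 t + w2 t * v2 t).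
apply: (@decay_of_derive_le V V' (- a) c (C / - a)) => //.
- by rewrite divr_ge0 // ltW.
- by move=> t _; rewrite addr_ge0 ?sqr_ge0.
- move=> t t0; have d1 := is_deriveM (dw1 t t0) (dw1 t t0).
  have d2 := is_deriveM (dw2 t t0) (dw2 t t0).
  have -> : V = w1 * w1 + w2 * w2 by apply/funext => x; rewrite /V !expr2.
  exact: is_deriveD d1 d2.
move=> t t0; have := leh t t0; set E := C * _ => hE.
have -> : C / - a * expR (- c * t) = E / - a by rewrite /E mulrAC.
rewrite -lerBlDl ler_pdivlMr // (le_trans _ hE) // /V' /V /v1 /v2.
rewrite -subr_ge0.
have -> : h1 t ^+ 2 + h2 t ^+ 2 -
  (w1 t * (a * w1 t - b * w2 t + h1 t) + w1 t * (a * w1 t - b * w2 t + h1 t) +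
   (w2 t * (a * w2 t + b * w1 t + h2 t) + w2 t * (a * w2 t + b * w1 t + h2 t)) -
   - - a * (w1 t ^+ 2 + w2 t ^+ 2)) * - a
  = (h1 t + a * w1 t) ^+ 2 + (h2 t + a * w2 t) ^+ 2 by ring.
by rewrite addr_ge0 ?sqr_ge0.
Qed.

(** f k stands for the k-th derivative of f 0 on the half-line. *)
Section Chain.
Variable f : nat -> R -> R.
Hypothesis df : forall k (t : R), 0 <= t -> is_derive t (1 : R) (f k) (f k.+1 t).

Lemma is_derive_comb (c : nat -> R) (N : nat) (t : R) : 0 <= t ->
  is_derive t (1 : R) (fun t => \sum_(k < N) c k * f k t)
    (\sum_(k < N) c k * f k.+1 t).
Proof.
move=> t0.
have -> : (fun t => \sum_(k < N) c k * f k t) = \sum_(k < N) (c k *: f k).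
  by apply/funext => x; rewrite fct_sumE.
apply: is_derive_sum => k; exact: is_deriveZ (df k t0).
Qed.

(** For phi the real or the imaginary part, this is phi applied to h(d/dt) (f 0). *)
Let comb (phi : R[i] -> R) (h : {poly R[i]}) t :=
  \sum_(k < size h) phi h`_k * f k t.

Lemma comb_widen (phi : R[i] -> R) (h : {poly R[i]}) N t :
  phi 0 = 0 -> (size h <= N)%N ->
  comb phi h t = \sum_(k < N) phi h`_k * f k t.
Proof.
move=> phi0 le_hN; rewrite /comb (big_ord_widen N (fun k => phi h`_k * f k t)) //.
rewrite big_mkcond; apply: eq_bigr => i _ /=; case: ltnP => // le_hi.
by rewrite nth_default // phi0 mul0r.
Qed.

Lemma combXsubC (phi : R[i] -> R) z (h : {poly R[i]}) t :
  phi 0 = 0 -> (forall x y, phi (x - y) = phi x - phi y) ->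
  comb phi (('X - z%:P) * h) t
  = \sum_(k < size h) phi h`_k * f k.+1 t - \sum_(k < size h) phi (z * h`_k) * f k t.
Proof.
move=> phi0 phiB.
rewrite (@comb_widen _ _ (size h).+1) //; last first.
  by rewrite (leq_trans (size_polyMleq _ _)) // size_XsubC.
under eq_bigr => k _ do
  rewrite mulrBl coefB mul_polyC coefZ ['X * h]mulrC coefMX phiB mulrBl.
rewrite sumrB; congr (_ - _).
  rewrite big_ord_recl /= phi0 mul0r add0r; apply: eq_bigr => i _.
  by rewrite /bump.
by rewrite big_ord_recr /= nth_default // mulr0 phi0 mul0r addr0.
Qed.

(** Roots are removed one at a time: w = h(d/dt) (f 0) solves w' = z w + v, where
    v is the function attached to (X - z) h. *)
Lemma comb_decay (s : seq R[i]) (h : {poly R[i]}) :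
  all (fun z => complex.Re z < 0) s ->
  exp_decay (comb (@complex.Re R) (\prod_(z <- s) ('X - z%:P) * h)) ->
  exp_decay (comb (@complex.Im R) (\prod_(z <- s) ('X - z%:P) * h)) ->
  exp_decay (comb (@complex.Re R) h) /\ exp_decay (comb (@complex.Im R) h).
Proof.
elim: s h => [|z s IHs] h /=; first by rewrite big_nil mul1r.
case/andP=> z0 s0; rewrite big_cons [_ * \prod_(i <- s) _]mulrC -mulrA => dR dI.
have [{}dR {}dI] := IHs _ s0 dR dI.
have eRe t : \sum_(k < size h) complex.Re h`_k * f k.+1 t
    = complex.Re z * comb (@complex.Re R) h t
      - complex.Im z * comb (@complex.Im R) h t
      + comb (@complex.Re R) (('X - z%:P) * h) t.
  rewrite combXsubC //; last by case=> [x1 x2] [y1 y2].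
  rewrite addrCA -[LHS]addr0; congr (_ + _); apply/esym/eqP.
  rewrite subr_eq0; apply/eqP.
  rewrite /comb !mulr_sumr -sumrB; apply: eq_bigr => k _.
  by case: z {z0 dR dI} h`_k => [z1 z2] [x1 x2] /=; ring.
have eIm t : \sum_(k < size h) complex.Im h`_k * f k.+1 t
    = complex.Re z * comb (@complex.Im R) h t
      + complex.Im z * comb (@complex.Re R) h t
      + comb (@complex.Im R) (('X - z%:P) * h) t.
  rewrite combXsubC //; last by case=> [x1 x2] [y1 y2].
  rewrite addrCA -[LHS]addr0; congr (_ + _); apply/esym/eqP.
  rewrite subr_eq0; apply/eqP.
  rewrite /comb !mulr_sumr -big_split; apply: eq_bigr => k _.
  by case: z {z0 dR dI eRe} h`_k => [z1 z2] [x1 x2] /=; ring.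
apply: (planar_decay (w1 := comb (@complex.Re R) h)
                     (w2 := comb (@complex.Im R) h) z0 dR dI) => t t0.
  by have := is_derive_comb (fun k => complex.Re h`_k) (size h) t0; rewrite eRe; apply.
by have := is_derive_comb (fun k => complex.Im h`_k) (size h) t0; rewrite eIm; apply.
Qed.

Lemma hurwitz_decay (g : {poly R}) : g != 0 -> hurwitz g ->
  (forall t : R, 0 <= t -> \sum_(k < size g) g`_k * f k t = 0) -> exp_decay (f 0).
Proof.
move=> nzg hg g0.
pose gC := map_poly (real_complex R) g.
have [s gs] := closed_field_poly_normal gC.
have nzl : lead_coef gC != 0 by rewrite lead_coef_eq0 map_poly_eq0.
have s_lt0 : all (fun z => complex.Re z < 0) s.
  apply/allP=> z zs; apply: hg; rewrite -/gC gs rootZ // /root horner_prod.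
  by rewrite (big_rem z) //= hornerXsubC subrr mul0r.
(* The constant factor puts gC in the form required by [comb_decay]. *)
have prodE : \prod_(z <- s) ('X - z%:P) * (lead_coef gC)%:P = gC.
  by rewrite mulrC mul_polyC -gs.
have dec phi x : (forall k, phi gC`_k = x * g`_k) ->
    exp_decay (comb phi (\prod_(z <- s) ('X - z%:P) * (lead_coef gC)%:P)).
  move=> e; rewrite prodE; exists 0, 1; split=> // t t0.
  rewrite mul0r /comb size_map_poly.
  under eq_bigr => k _ do rewrite e -mulrA.
  by rewrite -mulr_sumr g0 // mulr0 normr0.
have [] := comb_decay s_lt0 (dec (@complex.Re R) 1 _) (dec (@complex.Im R) 0 _).
- by move=> k; rewrite coef_map /= mul1r.
- by move=> k; rewrite coef_map /= mul0r.
move=> [c [a [a0 H]]] _.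
have lg : complex.Re (lead_coef gC) != 0.
  by rewrite lead_coef_map //= lead_coef_eq0.
exists (c / `|complex.Re (lead_coef gC)|), a; split=> // t t0.
have := H t t0; rewrite /comb size_polyC nzl big_ord1 coefC eqxx normrM => Ht.
by rewrite mulrAC ler_pdivlMr ?normr_gt0 // mulrC.
Qed.
End Chain.
End Decay.

Section Velocity.
Variable R : realType.

Lemma has_velocity_eq m (x v w : R -> 'cV[R]_m) :
  (forall t : R, 0 <= t -> v t = w t) -> has_velocity x v -> has_velocity x w.
Proof. by move=> e xv t i t0; rewrite -e //; exact: xv. Qed.

Lemma has_velocity_mul m n (M : 'M[R]_(m, n)) x v :
  has_velocity x v -> has_velocity (fun t => M *m x t) (fun t => M *m v t).
Proof.
move=> xv t i t0; rewrite mxE.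
have -> : (fun s : R => (M *m x s) i 0) = \sum_j (M i j *: (fun s => x s j 0)).
  by apply/funext=> s; rewrite mxE fct_sumE.
by apply: is_derive_sum => j; exact: is_deriveZ (xv t j t0).
Qed.

Lemma has_velocity_col m n (x v : R -> 'cV[R]_m) (y w : R -> 'cV[R]_n) :
  has_velocity x v -> has_velocity y w ->
  has_velocity (fun t => col_mx (x t) (y t)) (fun t => col_mx (v t) (w t)).
Proof.
move=> xv yw t i t0; case: (split_ordP i) => j ->.
  rewrite col_mxEu.
  have -> : (fun s : R => col_mx (x s) (y s) (lshift n j) 0) = (fun s => x s j 0).
    by apply/funext=> s; rewrite col_mxEu.
  exact: xv.
rewrite col_mxEd.
have -> : (fun s : R => col_mx (x s) (y s) (rshift m j) 0) = (fun s => y s j 0).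
  by apply/funext=> s; rewrite col_mxEd.
exact: yw.
Qed.

Lemma exp_decay_ext (f g : R -> R) : (forall t : R, 0 <= t -> f t = g t) ->
  exp_decay g -> exp_decay f.
Proof. by move=> fg [c [a [a0 H]]]; exists c, a; split=> // t t0; rewrite fg ?H. Qed.

Lemma exp_decayZ (k : R) (f : R -> R) : exp_decay f -> exp_decay (fun t => k * f t).
Proof.
move=> [c [a [a0 H]]]; exists (`|k| * c), a; split=> // t t0.
by rewrite normrM -mulrA ler_wpM2l // H.
Qed.

(** As the inputs do not reach the output, its k-th derivative is L Ae^k X. *)
Lemma output_decay N (Ae : 'M[R]_N) (L : 'rV[R]_N) (b1 b2 : 'cV[R]_N) (g : {poly R})
    (X : R -> 'cV[R]_N) (u1 u2 : R -> R) :
  g != 0 -> hurwitz g -> L *m mxeval Ae g = 0 ->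
  (forall k, (L *m Ae ^+ k *m b1) 0 0 = 0) ->
  (forall k, (L *m Ae ^+ k *m b2) 0 0 = 0) ->
  has_velocity X (fun t => Ae *m X t + u1 t *: b1 + u2 t *: b2) ->
  exp_decay (fun t => (L *m X t) 0 0).
Proof.
move=> nzg hg Lg L1 L2 dX.
pose f k t := (L *m Ae ^+ k *m X t) 0 0.
have -> : (fun t => (L *m X t) 0 0) = f 0%N.
  by apply/funext=> t; rewrite /f expr0 mulmx1.
apply: (hurwitz_decay _ nzg hg) => [k t t0|t t0].
  have := has_velocity_mul (L *m Ae ^+ k) dX 0 t0.
  rewrite !mulmxDr -!scalemxAr.
  rewrite (mx11_eq (L1 k)) (mx11_eq (L2 k)) raddf0 !scaler0 !addr0.
  by rewrite mulmxA -[L *m _ *m Ae]mulmxA mulmxE -exprSr.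
transitivity ((L *m mxeval Ae g *m X t) 0 0); last by rewrite Lg mul0mx mxE.
rewrite /mxeval mulmx_sumr mulmx_suml summxE; apply: eq_bigr => i _.
by rewrite -scalemxAr -scalemxAl mxE.
Qed.
End Velocity.

(** * Resolvents and strictly proper rational functions *)

(** Makes the lemmas on images of matrices by ring morphisms apply to [rcst]. *)
HB.instance Definition _ (R : realType) :=
  GRing.RMorphism.copy (@rcst R) (@FracField.tofrac {poly R} \o polyC).

Section TransferFunctions.
Variable R : realType.
Local Notation K := {fraction {poly R}}.
Local Notation s := (('X : {poly R})%:F).
Local Notation ratmx := (map_mx (@rcst R)).

Definition sI q (A : 'M[R]_q) : 'M[K]_q :=
  map_mx (@FracField.tofrac {poly R}) (char_poly_mx A).

Lemma sIE q (A : 'M[R]_q) : sI A = s%:M - ratmx A.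
Proof.
rewrite /sI /char_poly_mx map_mxB map_scalar_mx -map_mx_comp.
by congr (_ - _); apply/matrixP=> i j; rewrite !mxE.
Qed.

Lemma sI_unit q (A : 'M[R]_q) : sI A \in unitmx.
Proof.
rewrite unitmxE unitfE /sI det_map_mx tofrac_eq0.
exact: monic_neq0 (char_poly_monic A).
Qed.

Lemma sI_mul q k (A : 'M[R]_q) (X : 'M[K]_(q, k)) :
  sI A *m X = s *: X - ratmx A *m X.
Proof. by rewrite sIE mulmxBl mul_scalar_mx. Qed.

Lemma transferE q m p (A : 'M[R]_q) (B : 'M[R]_(q, m)) (C : 'M[R]_(p, q))
    (D : 'M[R]_(p, m)) (X : 'M[K]_(q, m)) :
  sI A *m X = ratmx B -> transfer A B C D = ratmx C *m X + ratmx D.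
Proof.
by rewrite /transfer -/(sI A) => <-; rewrite -mulmxA mulKmx ?sI_unit.
Qed.

(** The response (s - A)^-1 B of the state to the input, for zero initial
    conditions.  It is locked so that rewriting with associativity does not
    expand it. *)
Definition resolve q m (A : 'M[R]_q) (B : 'M[R]_(q, m)) : 'M[K]_(q, m) :=
  locked (invmx (sI A) *m ratmx B).

Lemma resolveK q m (A : 'M[R]_q) (B : 'M[R]_(q, m)) :
  sI A *m resolve A B = ratmx B.
Proof. by rewrite /resolve -lock mulKVmx ?sI_unit. Qed.

Lemma resolve_unique q m (A : 'M[R]_q) (B : 'M[R]_(q, m)) X :
  sI A *m X = ratmx B -> X = resolve A B.
Proof. by rewrite /resolve -lock => <-; rewrite mulKmx ?sI_unit. Qed.

Lemma resolve_mulr q m p (A : 'M[R]_q) (B : 'M[R]_(q, m)) (M : 'M[R]_(m, p)) :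
  resolve A (B *m M) = resolve A B *m ratmx M.
Proof. by apply/esym/resolve_unique; rewrite mulmxA resolveK map_mxM. Qed.

Lemma map_poly_rcst_horner (p : {poly R}) : (map_poly (@rcst R) p).[s] = p%:F.
Proof.
rewrite (horner_coef_wide s (leqnn _)) size_map_poly.
rewrite -[in RHS](coefK p) poly_def rmorph_sum; apply: eq_bigr => i _.
by rewrite coef_map -mul_polyC rmorphM rmorphXn.
Qed.

Lemma mxeval_scalar (F : comNzRingType) q (a : F) (p : {poly F}) :
  mxeval (a%:M : 'M[F]_q) p = (p.[a])%:M.
Proof.
rewrite horner_coef /mxeval [RHS]raddf_sum; apply: eq_bigr => i _ /=.
by rewrite -(rmorphXn (@scalar_mx F q)) /= scale_scalar_mx.
Qed.

Lemma mxeval_ratmx q (A : 'M[R]_q) (p : {poly R}) :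
  mxeval (ratmx A) (map_poly (@rcst R) p) = ratmx (mxeval A p).
Proof.
rewrite /mxeval size_map_poly raddf_sum; apply: eq_bigr => i _ /=.
rewrite coef_map map_mxZ; congr (_ *: _).
by elim: (val i) => [|k IH]; rewrite ?expr0 ?map_mx1 // !exprS IH -!mulmxE map_mxM.
Qed.

(** The divided difference (p(s) - p(A)) / (s - A). *)
Definition sdiff q (A : 'M[R]_q) (p : {poly R}) : 'M[K]_q :=
  \sum_(j < size p) s ^+ j *: ratmx (mxeval A (drop_poly j.+1 p)).

Lemma sdiffP q (A : 'M[R]_q) (p : {poly R}) :
  sI A *m sdiff A p = (p%:F)%:M - ratmx (mxeval A p).
Proof.
have -> : sdiff A p = mxdiff (ratmx A) s%:M 1%:M (map_poly (@rcst R) p).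
  rewrite /mxdiff size_map_poly; apply: eq_bigr => j _.
  rewrite mulmx1 -(rmorphXn (@scalar_mx K q)) mul_mx_scalar -mxeval_ratmx.
  by congr (_ *: mxeval _ _); apply/polyP=> i; rewrite !(coef_drop_poly, coef_map).
have := mxdiffP (ratmx A) s%:M 1%:M (map_poly (@rcst R) p).
rewrite mxeval_scalar map_poly_rcst_horner mul1mx mulmx1 mxeval_ratmx.
rewrite mul_mx_scalar sI_mul => e; apply/eqP; rewrite subr_eq addrAC.
by rewrite eq_sym subr_eq -e addrC.
Qed.

(** The Laplace transform of p(A) x, where x' = A x + B u: it is p(d/dt) x up to
    the inputs produced by the successive derivatives. *)
Lemma mxeval_resolve q m (A : 'M[R]_q) (B : 'M[R]_(q, m)) p :
  ratmx (mxeval A p) *m resolve A B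
  = p%:F *: resolve A B - sdiff A p *m ratmx B.
Proof.
apply: (can_inj (mulKmx (sI_unit A))).
rewrite [RHS]mulmxBr -scalemxAr [sI A *m (sdiff _ _ *m _)]mulmxA sdiffP.
rewrite resolveK mulmxBl mul_scalar_mx opprB addrC subrK.
have comm : sI A *m ratmx (mxeval A p) = ratmx (mxeval A p) *m sI A.
  rewrite sIE mulmxBl mulmxBr mul_scalar_mx mul_mx_scalar -!map_mxM.
  by rewrite (mxeval_intertwine p (erefl (A *m A))).
by rewrite mulmxA comm -mulmxA resolveK.
Qed.

Definition sproper (x : K) : Prop :=
  exists a b : {poly R}, [/\ b != 0, (size a < size b)%N & x = a%:F / b%:F].

Lemma sproper_frac (a b : {poly R}) : (size a < size b)%N -> sproper (a%:F / b%:F).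
Proof.
by move=> ab; exists a, b; split=> //; rewrite -size_poly_gt0 (leq_ltn_trans _ ab).
Qed.

Lemma sproper0 : sproper 0.
Proof. by exists 0, 1; rewrite oner_eq0 size_poly0 size_poly1 rmorph0 mul0r. Qed.

Lemma sproperN x : sproper x -> sproper (- x).
Proof.
by move=> [a [b [nz ab ->]]]; exists (- a), b; rewrite size_polyN rmorphN mulNr.
Qed.

Lemma ltn_size_mul (a b c : {poly R}) : (size a < size b)%N -> c != 0 ->
  (size (a * c)%R < size (b * c)%R)%N.
Proof.
move=> ab nzc; have nzb : b != 0 by rewrite -size_poly_gt0 (leq_ltn_trans _ ab).
have [->|nza] := eqVneq a 0.
  by rewrite mul0r size_poly0 size_poly_gt0 mulf_neq0.
rewrite !size_mul // -!subn1 ltn_sub2rE ?ltn_add2r //.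
by rewrite addn_gt0 size_poly_gt0 nza.
Qed.

Lemma sproperD x y : sproper x -> sproper y -> sproper (x + y).
Proof.
move=> [a [b [nzb ab ->]]] [c [e [nze ce ->]]].
exists (a * e + c * b), (b * e); split; first exact: mulf_neq0.
  rewrite (leq_ltn_trans (size_polyD _ _)) // gtn_max ltn_size_mul //.
  by rewrite [b * e]mulrC ltn_size_mul.
by rewrite tofracD !tofracM addf_div ?tofrac_eq0.
Qed.

Lemma sproperB x y : sproper x -> sproper y -> sproper (x - y).
Proof. by move=> px py; apply: sproperD px (sproperN py). Qed.

Lemma sproperM x y : sproper x -> sproper y -> sproper (x * y).
Proof.
move=> [a [b [nzb ab ->]]] [c [e [nze ce ->]]].
exists (a * c), (b * e); split; first exact: mulf_neq0.
  have [->|nzc] := eqVneq c 0.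
    by rewrite mulr0 size_poly0 size_poly_gt0 mulf_neq0.
  rewrite (ltn_trans (ltn_size_mul ab nzc)) // ![b * _]mulrC.
  exact: ltn_size_mul.
by rewrite !tofracM mulf_div.
Qed.

Lemma sproper_divX x k : sproper (s ^+ k.+1 * x) -> sproper (s ^+ k * x).
Proof.
have nzs : s != 0 by rewrite tofrac_eq0 polyX_eq0.
move=> px; have -> : s ^+ k * x = s^-1 * (s ^+ k.+1 * x).
  by rewrite exprS -mulrA mulKf.
apply: sproperM px; exists 1, 'X; rewrite polyX_eq0 size_poly1 size_polyX.
by rewrite tofrac1 div1r.
Qed.

Lemma sproper_const a : sproper (rcst a) -> a = 0.
Proof.
move=> [b [c [nzc bc e]]]; apply/eqP/negP => /negP nza.
have : a%:P * c = b.
  apply/eqP; rewrite -tofrac_eq rmorphM /= -[_%:F]/(rcst a) e.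
  by rewrite divfK ?tofrac_eq0.
move/(congr1 (fun p : {poly R} => size p)); rewrite mul_polyC size_scale // => e'.
by rewrite e' ltnn in bc.
Qed.

Lemma sproper_neq1 x : sproper x -> 1 - x != 0.
Proof.
move=> px; apply/eqP=> /eqP; rewrite subr_eq0 => /eqP x1.
have := @sproper_const 1; rewrite rmorph1 x1 => /(_ px) /eqP.
by rewrite oner_eq0.
Qed.

(** By Cayley-Hamilton, [mxeval_resolve] for the characteristic polynomial writes
    the resolvent as a polynomial matrix over this polynomial. *)
Lemma tf_fraction q (A : 'M[R]_q) (B : 'cV[R]_q) (C : 'rV[R]_q) :
  exists2 w : {poly R}, (size w <= q)%N &
    (ratmx C *m resolve A B) 0 0 = w%:F / (char_poly A)%:F.
Proof.
set p := char_poly A.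
have nzp : p%:F != 0 by rewrite tofrac_eq0 (monic_neq0 (char_poly_monic A)).
have size_p : size p = q.+1 by rewrite size_char_poly.
exists (\poly_(j < q) (C *m mxeval A (drop_poly j.+1 p) *m B) 0 0).
  exact: size_poly.
have := mxeval_resolve A B p; rewrite mxeval_char_poly map_mx0 mul0mx.
move/esym/eqP; rewrite subr_eq0 => /eqP e.
apply: (mulfI nzp); rewrite mulrCA divff // mulr1.
transitivity ((ratmx C *m (p%:F *: resolve A B)) 0 0).
  by rewrite -scalemxAr [RHS]mxE.
rewrite e /sdiff size_p big_ord_recr /= drop_poly_eq0 ?size_p //.
rewrite {2}/mxeval size_poly0 big_ord0 map_mx0 scaler0 addr0.
rewrite mulmx_suml mulmx_sumr summxE poly_def rmorph_sum; apply: eq_bigr => j _.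
rewrite -scalemxAl -scalemxAr mulmxA -!map_mxM !mxE -mul_polyC rmorphM rmorphXn.
by rewrite mulrC.
Qed.

Lemma sproper_tf q (A : 'M[R]_q) (B : 'cV[R]_q) (C : 'rV[R]_q) :
  sproper ((ratmx C *m resolve A B) 0 0).
Proof.
have [w w_q ->] := tf_fraction A B C.
exists w, (char_poly A); split => //.
  exact: monic_neq0 (char_poly_monic A).
by rewrite size_char_poly ltnS.
Qed.

(** The output C A x is the derivative of C x, minus the direct effect of the
    input. *)
Lemma resolve_shift q (A : 'M[R]_q) (B : 'cV[R]_q) (C : 'rV[R]_q) :
  (ratmx (C *m A) *m resolve A B) 0 0
  = s * (ratmx C *m resolve A B) 0 0 - rcst ((C *m B) 0 0).
Proof.
have : ratmx A *m resolve A B = s *: resolve A B - ratmx B.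
  by rewrite -(resolveK A B) sI_mul opprB addrC subrK.
move=> e; rewrite map_mxM -mulmxA e mulmxBr -scalemxAr -map_mxM.
by rewrite !mxE.
Qed.

(** The transfer function expands at infinity as the sum of the C A^i B / s^(i+1).
    The coefficients are read off one at a time: replacing C by C A multiplies
    the function by s and removes the leading term ([resolve_shift]), and a
    constant that is strictly proper is 0. *)
Lemma markov_eq q (A : 'M[R]_q) (B : 'cV[R]_q) (C : 'rV[R]_q) k a :
  sproper (s ^+ k.+1 * (ratmx C *m resolve A B) 0 0 - rcst a) ->
  (C *m A ^+ k *m B) 0 0 = a
  /\ forall i, (i < k)%N -> (C *m A ^+ i *m B) 0 0 = 0.
Proof.
elim: k C => [|k IHk] C pC.
  split=> //; rewrite expr0 mulmx1; apply/eqP; rewrite -subr_eq0; apply/eqP.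
  apply: sproper_const; rewrite rmorphB /=.
  have := sproperB pC (sproper_tf A B (C *m A)).
  by rewrite resolve_shift expr1 addrAC opprB addrCA addrN addr0.
have CB0 : (C *m B) 0 0 = 0.
  apply: sproper_const.
  suff pC1 : sproper (s * (ratmx C *m resolve A B) 0 0).
    have := sproperB pC1 (sproper_tf A B (C *m A)).
    by rewrite resolve_shift opprB addrCA addrN addr0.
  rewrite -[s]expr1.
  have : sproper (s ^+ k.+1 * (ratmx C *m resolve A B) 0 0).
    have nzs : s != 0 by rewrite tofrac_eq0 polyX_eq0.
    have ps a' : sproper (s^-1 * rcst a').
      exists a'%:P, 'X; rewrite polyX_eq0 size_polyX size_polyC ltnS leq_b1.
      by rewrite mulrC.
    have -> : s ^+ k.+1 * (ratmx C *m resolve A B) 0 0 =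
      s^-1 * (s ^+ k.+2 * (ratmx C *m resolve A B) 0 0 - rcst a) + s^-1 * rcst a.
      by rewrite -mulrDr subrK [s ^+ k.+2]exprS -mulrA mulKf.
    apply: sproperD (ps a); apply: sproperM pC.
    by have := ps 1; rewrite rmorph1 mulr1.
  elim: k {IHk pC} => // k IHk /sproper_divX; exact: IHk.
have /IHk[CAk CAi] :
    sproper (s ^+ k.+1 * (ratmx (C *m A) *m resolve A B) 0 0 - rcst a).
  by rewrite resolve_shift CB0 rmorph0 subr0 mulrA -exprSr.
split=> [|[_|i i_k]].
- by rewrite exprS -mulmxE mulmxA.
- by rewrite expr0 mulmx1.
- by rewrite exprS -mulmxE mulmxA CAi.
Qed.

Lemma markov0 q (A : 'M[R]_q) (B : 'cV[R]_q) (C : 'rV[R]_q) a :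
  (ratmx C *m resolve A B) 0 0 = rcst a ->
  a = 0 /\ forall k, (C *m A ^+ k *m B) 0 0 = 0.
Proof.
move=> e; have a0 : a = 0 by apply: sproper_const; rewrite -e; exact: sproper_tf.
split=> // k; have : sproper (s ^+ k.+1 * (ratmx C *m resolve A B) 0 0 - rcst 0).
  by rewrite e a0 rmorph0 mulr0 subr0; exact: sproper0.
by case/markov_eq.
Qed.

Lemma markov_lt q k (A : 'M[R]_q) (B : 'cV[R]_q) (C : 'rV[R]_q) :
  sproper (s ^+ k * (ratmx C *m resolve A B) 0 0) ->
  forall i, (i < k)%N -> C *m A ^+ i *m B = 0.
Proof.
case: k => // k pC i; have [|Ck Ci] := @markov_eq _ A B C k 0.
  by rewrite rmorph0 subr0.
rewrite ltnS leq_eqVlt => ik; rewrite -(raddf0 (@scalar_mx R 1)); apply: mx11_eq.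
by case/orP: ik => [/eqP-> //|/Ci].
Qed.

(** The transfer-function counterpart of [mxdiff_markov]. *)
Lemma sdiff_markov q k (A : 'M[R]_q) (B : 'cV[R]_q) (C : 'rV[R]_q) (p : {poly R}) :
  (forall i, (i < k)%N -> C *m A ^+ i *m B = 0) -> size p = k.+2 ->
  ratmx C *m sdiff A p *m ratmx B = ratmx (C *m mxeval A (drop_poly 1 p) *m B).
Proof.
move=> CAB sp; rewrite /sdiff mulmx_sumr mulmx_suml sp big_ord_recl expr0 scale1r.
rewrite big1 ?addr0 => [|i _]; first by rewrite -!map_mxM.
rewrite -scalemxAr -scalemxAl -!map_mxM lift0.
by rewrite (mxeval_drop_markov CAB) ?sp // map_mx0 scaler0.
Qed.

Lemma tf_size q (A : 'M[R]_q) (B : 'cV[R]_q) (C : 'rV[R]_q) (D N : {poly R}) :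
  D != 0 -> coprimep D N -> (ratmx C *m resolve A B) 0 0 = N%:F / D%:F ->
  (size D <= q.+1)%N.
Proof.
move=> nzD DN; have [w _ ->] := tf_fraction A B C => e.
have nzp : char_poly A != 0 := monic_neq0 (char_poly_monic A).
rewrite -(size_char_poly A); apply: dvdp_leq => //.
rewrite -(Gauss_dvdpr _ DN); apply/dvdpP; exists w.
apply/eqP; rewrite -tofrac_eq !rmorphM /=; apply/eqP.
move/(congr1 (fun x => x * D%:F * (char_poly A)%:F)): e.
by rewrite divfK ?tofrac_eq0 // mulrAC divfK ?tofrac_eq0.
Qed.

(** If g(A) B = 0, then g (s - A)^-1 B is a polynomial vector, so that g N / D is a
    polynomial. *)
Lemma annihilator_size q (A : 'M[R]_q) (B : 'cV[R]_q) (C : 'rV[R]_q)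
    (D N g : {poly R}) :
  D != 0 -> coprimep D N -> (ratmx C *m resolve A B) 0 0 = N%:F / D%:F ->
  g != 0 -> mxeval A g *m B = 0 -> (size D <= size g)%N.
Proof.
move=> nzD DN e nzg gB; apply: dvdp_leq => //.
rewrite -(Gauss_dvdpr _ DN).
pose w := \sum_(j < size g) (C *m mxeval A (drop_poly j.+1 g) *m B) 0 0 *: 'X^j.
apply/dvdpP; exists w.
have gX : g%:F *: resolve A B = sdiff A g *m ratmx B.
  apply: (can_inj (mulKmx (sI_unit A))).
  rewrite -scalemxAr resolveK mulmxA sdiffP mulmxBl mul_scalar_mx -map_mxM gB.
  by rewrite map_mx0 subr0.
apply/eqP; rewrite -tofrac_eq !rmorphM /=; apply/eqP.
have -> : w%:F = g%:F * (N%:F / D%:F).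
  rewrite -e; transitivity ((ratmx C *m (g%:F *: resolve A B)) 0 0); last first.
    by rewrite -scalemxAr [LHS]mxE.
  rewrite gX /sdiff mulmx_suml mulmx_sumr summxE rmorph_sum; apply: eq_bigr => j _.
  rewrite -scalemxAl -scalemxAr mulmxA -!map_mxM !mxE -mul_polyC rmorphM rmorphXn.
  by rewrite mulrC.
by rewrite -mulrA divfK ?tofrac_eq0 // mulrC.
Qed.

(** Otherwise the vectors A^k B with k < n are linearly dependent, which gives a
    polynomial g of degree less than n with g(A) B = 0 and contradicts
    [annihilator_size]. *)
Lemma controllable n (A : 'M[R]_n) (B : 'cV[R]_n) (C W : 'rV[R]_n)
    (D N : {poly R}) :
  size D = n.+1 -> coprimep D N -> (ratmx C *m resolve A B) 0 0 = N%:F / D%:F ->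
  (forall k, (W *m A ^+ k *m B) 0 0 = 0) -> W = 0.
Proof.
move=> sD DN e WAB.
have nzD : D != 0 by rewrite -size_poly_gt0 sD.
pose Q : 'M[R]_n := \matrix_(i, k) (A ^+ k *m B) i 0.
have WQ : W *m Q = 0.
  apply/rowP=> k; rewrite [RHS]mxE -(WAB k) -mulmxA !mxE.
  by apply: eq_bigr => i _; rewrite !mxE.
have [Qu|] := boolP (Q \in unitmx); first by rewrite -(mulmxK Qu W) WQ mul0mx.
rewrite -unitmx_tr unitmxE unitfE negbK => /det0P[v nzv vQ].
have nzg : rVpoly v != 0.
  by apply: contraNneq nzv => v0; rewrite -(rVpolyK v) v0 linear0.
have := annihilator_size nzD DN e nzg; rewrite sD ltnNge size_poly => H.
suff /H : mxeval A (rVpoly v) *m B = 0 by [].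
rewrite (@mxeval_widen _ _ _ _ n) ?size_poly // mulmx_suml; apply/colP=> i.
transitivity ((v *m Q^T) 0 i); last by rewrite vQ !mxE.
rewrite summxE [RHS]mxE; apply: eq_bigr => k _.
by rewrite coef_rVpoly_ord -scalemxAl !mxE.
Qed.

(** * Transfer functions of the controllers *)

Lemma siso_tfE q (S : siso R q) :
  siso_tf S = (ratmx (sisoC S) *m resolve (sisoA S) (sisoB S)) 0 0.
Proof.
by rewrite /siso_tf (transferE _ _ (resolveK _ _)) map_mx0 addr0.
Qed.

(** As N and D are monic, s^(k+1) N/D - 1 is strictly proper. *)
Lemma relative_degree_gain n k (P : siso R n) (D N : {poly R}) :
  D \is monic -> N \is monic -> size D = n.+1 -> size N = (n - k.+1).+1 ->
  (k < n)%N -> siso_tf P = N%:F / D%:F ->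
  sisoC P *m sisoA P ^+ k *m sisoB P = 1%:M
  /\ forall i, (i < k)%N -> sisoC P *m sisoA P ^+ i *m sisoB P = 0.
Proof.
move=> mD mN sD sN kn eP.
have nzD : D%:F != 0 :> K by rewrite tofrac_eq0 monic_neq0.
have [|Ck Ci] := @markov_eq _ (sisoA P) (sisoB P) (sisoC P) k 1; last first.
  split=> [|i ik]; first exact: mx11_eq.
  by rewrite -(raddf0 (@scalar_mx R 1)); apply: mx11_eq; exact: Ci.
rewrite -siso_tfE eP rmorph1.
have -> : s ^+ k.+1 * (N%:F / D%:F) - 1 = ('X^(k.+1) * N - D)%:F / D%:F.
  by rewrite tofracB tofracM tofracXn mulrBl mulfV // mulrA.
apply: sproper_frac; rewrite sD ltnS; apply/leq_sizeP=> j.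
have mXN : 'X^(k.+1) * N \is monic by rewrite monicMl ?monicXn.
have sXN : size ('X^(k.+1) * N) = n.+1.
  by rewrite size_monicM ?monicXn ?monic_neq0 // size_polyXn sN; lia.
rewrite leq_eqVlt coefB => /orP[/eqP<-|nj]; last first.
  by rewrite !nth_default ?subrr ?sXN ?sD.
move/monicP: mXN; move/monicP: mD; rewrite !lead_coefE sXN sD /= => -> ->.
exact: subrr.
Qed.

Lemma siso_sproper q (S : siso R q) : sproper (siso_tf S).
Proof. by rewrite siso_tfE; exact: sproper_tf. Qed.

(** The closed loop of P with u = f v, where v = a u + g0 y + r and the matching
    identity dm P = 1 - a - g0 P holds: on the trajectories v = u - dm y + r, so
    neither a nor g0 remains.  It is used with v = theta^T phi, and with a = 1
    and g0 = - dm for the parameter-independent controller. *)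
Lemma loop_tf (F : fieldType) (dm a g0 P f k0 k1 : F) :
  dm * P = 1 - a - g0 * P -> 1 - f * a != 0 ->
  k0 = f * (g0 + a * k0) -> k1 = f * (1 + a * k1) ->
  P * k1 / (1 - P * k0) = P * f / (1 - f + f * (dm * P)).
Proof.
move=> e nz e0 e1.
have -> : k0 = f * g0 / (1 - f * a).
  by apply: (mulIf nz); rewrite divfK // mulrBr mulr1 {1}e0; ring.
have -> : k1 = f / (1 - f * a).
  by apply: (mulIf nz); rewrite divfK // mulrBr mulr1 {1}e1; ring.
have -> : 1 - P * (f * g0 / (1 - f * a)) = (1 - f + f * (dm * P)) / (1 - f * a).
  by rewrite e; field.
rewrite invf_div; set w := 1 - f * a in nz *; set x := 1 - f + _.
by rewrite [P * (f / w)]mulrA -[_ * (w / x)]mulrA mulKf.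
Qed.

Lemma loop_tf_inv (F : fieldType) (dm P k0 k1 : F) :
  dm != 0 -> P != 0 -> dm^-1 = P * k1 / (1 - P * k0) -> P^-1 = k0 + dm * k1.
Proof.
move=> nzdm nzP.
have [->|nz] := eqVneq (1 - P * k0) 0.
  by rewrite invr0 mulr0 => /eqP; rewrite invr_eq0 (negPf nzdm).
move=> e; apply: (mulfI nzP); rewrite mulfV // mulrDr.
suff -> : P * (dm * k1) = 1 - P * k0 by rewrite addrC subrK.
by rewrite mulrCA; apply: (mulfI (invr_neq0 nzdm)); rewrite mulKf // e divfK.
Qed.

Lemma mul_mx11 (F : comNzRingType) m (M : 'M[F]_1) (U : 'M[F]_(1, m)) :
  M *m U = M 0 0 *: U.
Proof. by rewrite {1}[M]mx11_scalar mul_scalar_mx. Qed.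

Lemma sI_block m l (A11 : 'M[R]_m) A12 A21 (A22 : 'M[R]_l) :
  sI (block_mx A11 A12 A21 A22)
  = block_mx (sI A11) (- ratmx A12) (- ratmx A21) (sI A22).
Proof.
rewrite !sIE map_block_mx [s%:M]scalar_mx_block opp_block_mx add_block_mx.
by rewrite !add0r.
Qed.

Section Phi.
Variables (n q : nat) (G : phi_filter R n q) (theta : 'cV[R]_(2 * n)).

Let thC := theta^T *m phiC G.
Let thD := theta^T *m phiD G.

(** The transfer functions from u, and from (y, r), to theta^T phi. *)
Definition phi_u : K := (ratmx thC *m resolve (phiA G) (phiBu G)) 0 0.
Definition phi_yr : 'rV[K]_2 :=
  ratmx thC *m resolve (phiA G) (phiB G) + ratmx thD.

(** The coefficients of u and of r in the matching equation. *)
Lemma plant_identity (D N Dm lam : {poly R}) :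
  realizes_phi lam G -> Dm != 0 -> plant_parameter D N Dm lam theta ->
  Dm%:F * (N%:F / D%:F) = 1 - phi_u - phi_yr 0 0 * (N%:F / D%:F)
  /\ phi_yr 0 1 = 1.
Proof.
move=> hG nzDm hp.
have e : ratmx theta^T *m phi_tf n lam =
    row_mx (ratmx thC *m resolve (phiA G) (phiBu G)) phi_yr.
  have eX : sI (phiA G) *m row_mx (resolve (phiA G) (phiBu G))
                                  (resolve (phiA G) (phiB G)) =
      ratmx (row_mx (phiBu G) (phiB G)).
    by rewrite mul_mx_row !resolveK map_row_mx.
  rewrite -hG (transferE _ _ eX) map_row_mx map_mx0 mulmxDr !mul_mx_row add_row_mx.
  by rewrite mulmx0 addr0 /phi_yr !mulmxA !map_mxM.
have ev U Rf : ((map_mx (@rcst R) theta)^T *m (phi_tf n lam *m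
     col_mx U%:M (col2 (N%:F / D%:F * U) Rf))) 0 0
   = phi_u * U + phi_yr 0 0 * (N%:F / D%:F * U) + phi_yr 0 1 * Rf.
  rewrite map_trmx mulmxA e mul_row_col mul_mx_scalar mxE -addrA.
  congr (_ + _); first by rewrite mxE mulrC.
  move: phi_yr => g; rewrite mxE big_ord_recr big_ord1 /= !mxE /=.
  by congr (g 0 _ * _ + g 0 _ * _); apply: val_inj.
have nzd : Dm%:F != 0 :> K by rewrite tofrac_eq0.
split.
  (* Unit input and no reference, then the converse. *)
  have := hp 1 0; rewrite /= ev mul0r subr0 !mulr1 mulr0 addr0 => ->.
  by rewrite opprD addrA.
have := hp 0 1; rewrite /= ev !mulr0 !add0r mulr1 mulrN div1r divff //.
by move/oppr_inj => <-.
Qed.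

Lemma filter_response m (X : 'M[K]_(q, m)) (V : 'M[K]_(1, m)) (B : 'M[R]_(q, m)) :
  sI (phiA G) *m X = ratmx B + ratmx (phiBu G) *m V ->
  ratmx thC *m X = ratmx thC *m resolve (phiA G) B + phi_u *: V.
Proof.
move=> e; have -> : X = resolve (phiA G) B + resolve (phiA G) (phiBu G) *m V.
  apply: (can_inj (mulKmx (sI_unit (phiA G)))).
  by rewrite e mulmxDr [sI _ *m (_ *m V)]mulmxA !resolveK.
by rewrite mulmxDr mulmxA mul_mx11.
Qed.

Lemma mrc_tf : ctr_tf (mrc G theta) = phi_yr + phi_u *: ctr_tf (mrc G theta).
Proof.
rewrite /ctr_tf /=.
set A := phiA G + _; set B := phiB G + _.
rewrite (transferE _ _ (resolveK A B)).
set X := resolve A B; rewrite -/thC -/thD; set U := _ + _.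
have eX : sI (phiA G) *m X = ratmx (phiB G) + ratmx (phiBu G) *m U.
  have := resolveK A B; rewrite -/X !sI_mul /A /B => /eqP.
  rewrite subr_eq => /eqP ->.
  rewrite !map_mxD mulmxDl /U mulmxDr !map_mxM !mulmxA.
  rewrite [ratmx (phiA G) *m X + _]addrC addrA addrK -addrA.
  by rewrite [ratmx _ *m _ *m _ + _]addrC.
by rewrite {1}/U (filter_response eX) addrAC.
Qed.

Lemma filtered_mrc_tf l (F : siso R l) (U := ctr_tf (filtered_mrc G F theta)) :
  U = siso_tf F *: (phi_yr + phi_u *: U).
Proof.
rewrite {}/U /ctr_tf /=.
set A := block_mx _ _ _ _; set B := col_mx _ _.
rewrite (transferE _ _ (resolveK A B)) map_mx0 addr0 map_row_mx map_mx0.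
have := resolveK A B.
rewrite -[resolve A B]vsubmxK sI_block map_col_mx mul_block_col.
set X := usubmx _; set Z := dsubmx _; case/eq_col_mx=> eX eZ.
rewrite mul_row_col mul0mx add0r; set U := ratmx (sisoC F) *m Z.
have {}eX : sI (phiA G) *m X = ratmx (phiB G) + ratmx (phiBu G) *m U.
  by rewrite -eX mulNmx map_mxM -mulmxA subrK.
have {}eZ : Z = resolve (sisoA F) (sisoB F) *m (phi_yr + phi_u *: U).
  apply: (can_inj (mulKmx (sI_unit (sisoA F)))); rewrite mulmxA resolveK.
  rewrite /phi_yr addrAC -(filter_response eX) mulmxDr -map_mxM -eZ mulNmx.
  by rewrite addrA !map_mxM !mulmxA subrr add0r.
by rewrite {1}/U eZ mulmxA mul_mx11 siso_tfE.
Qed.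
End Phi.

Lemma closed_loop_tfE n q (P : siso R n) (C : controller R q)
    (dm a f : K) (g0 : 'rV[K]_2) :
  dm * siso_tf P = 1 - a - g0 0 0 * siso_tf P -> g0 0 1 = 1 -> 1 - f * a != 0 ->
  ctr_tf C = f *: (g0 + a *: ctr_tf C) ->
  closed_loop_tf P C = siso_tf P * f / (1 - f + f * (dm * siso_tf P)).
Proof.
by move=> e g1 nz eC; apply: (loop_tf e nz); rewrite {1}eC !mxE // g1.
Qed.

Lemma closed_loop_mrc n q lam (G : phi_filter R n q) theta (P : siso R n) D N Dm :
  realizes_phi lam G -> Dm != 0 -> plant_parameter D N Dm lam theta ->
  siso_tf P = N%:F / D%:F -> siso_tf P != 0 ->
  closed_loop_tf P (mrc G theta) = Dm%:F^-1.
Proof.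
move=> hG nzDm hp eP nzP.
have [e1 e2] := plant_identity hG nzDm hp; rewrite -eP in e1.
rewrite (closed_loop_tfE (f := 1) e1 e2); first last.
- by rewrite scale1r; exact: mrc_tf.
- by rewrite mul1r; apply: sproper_neq1; exact: sproper_tf.
by rewrite subrr add0r mulr1 mul1r invfM mulrCA mulfV // mulr1.
Qed.

(** * The unfiltered controller *)

(** The controllable canonical form, with state response s^i / D. *)
Definition companion_siso n (D N : {poly R}) : siso R n :=
  Siso (\matrix_(i, j) if (i.+1 < n)%N then (j == i.+1 :> nat)%:R else - D`_j)
       (\col_i (i.+1 == n)%:R) (\row_j N`_j).

Lemma tofrac_poly n (p : {poly R}) : (size p <= n)%N ->
  p%:F = \sum_(j < n) rcst p`_j * s ^+ j.
Proof.
move=> sp; have {1}-> : p = \sum_(j < n) p`_j *: 'X^j.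
  rewrite -poly_def; apply/polyP=> i; rewrite coef_poly; case: ltnP => // ni.
  by rewrite nth_default // (leq_trans sp).
by rewrite rmorph_sum; apply: eq_bigr => j _; rewrite -mul_polyC rmorphM rmorphXn.
Qed.

Lemma companion_tf n (D N : {poly R}) :
  D \is monic -> size D = n.+1 -> (size N <= n)%N ->
  siso_tf (companion_siso n D N) = N%:F / D%:F.
Proof.
move=> mD sD sN; pose X : 'cV[K]_n := \col_i (s ^+ i / D%:F).
have nzD : D%:F != 0 :> K by rewrite tofrac_eq0 monic_neq0.
have eX : sI (sisoA (companion_siso n D N)) *m X =
    ratmx (sisoB (companion_siso n D N)).
  apply/colP=> i; rewrite sI_mul !mxE.
  under eq_bigr => j _ do rewrite !mxE.
  have := ltn_ord i; rewrite leq_eqVlt => /orP[/eqP in1|i_n].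
    rewrite in1 ltnn eqxx rmorph1.
    under eq_bigr => j _ do rewrite rmorphN mulNr mulrA.
    rewrite sumrN opprK -mulr_suml mulrA -exprS in1 -mulrDl.
    have := tofrac_poly (leqnn (size D)); rewrite sD big_ord_recr /=.
    have -> : D`_n = 1 by move/monicP: mD; rewrite lead_coefE sD.
    by rewrite rmorph1 mul1r addrC => <-; rewrite mulfV.
  rewrite i_n (bigD1 (Ordinal i_n)) //= eqxx rmorph1 mul1r exprS mulrA.
  rewrite big1 ?addr0 ?subrr; first by rewrite (ltn_eqF i_n) rmorph0.
  move=> j; rewrite -val_eqE /= => /negPf ->; by rewrite rmorph0 mul0r.
rewrite siso_tfE -(resolve_unique eX) mxE (tofrac_poly sN) mulr_suml.
by apply: eq_bigr => j _; rewrite !mxE mulrA.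
Qed.

Lemma minimal_siso n (P : siso R n) (D N : {poly R}) :
  coprimep D N -> size D = n.+1 -> siso_tf P = N%:F / D%:F -> minimal P.
Proof.
move=> DN sD eP q' S'; rewrite eP siso_tfE => e.
have nzD : D != 0 by rewrite -size_poly_gt0 sD.
by have := tf_size nzD DN e; rewrite sD.
Qed.

(** With Q the quotient and -b the remainder of lam Dm by D, take a = lam - N Q.
    Both lam and N Q are monic of degree n, so a has lower degree. *)
Lemma matching n (D N Dm lam : {poly R}) m d :
  D \is monic -> N \is monic -> Dm \is monic -> lam \is monic ->
  size D = n.+2 -> size N = m.+1 -> size Dm = d.+2 -> size lam = n.+1 ->
  (m + d = n)%N ->
  exists a b : {poly R}, [/\ (size a <= n)%N, (size b <= n.+1)%N &
    lam * Dm * N = (lam - a) * D - b * N].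
Proof.
move=> mD mN mDm mlam sD sN sDm slam md.
have nzD := monic_neq0 mD; have nzlam := monic_neq0 mlam.
pose L := lam * Dm; pose Q := L %/ D; pose b := - (L %% D).
have mL : L \is monic by rewrite monicMl.
have sL : size L = (n + d).+2.
  by rewrite size_monicM ?monic_neq0 // slam sDm; lia.
have LE : L = Q * D - b by rewrite /b opprK; exact: divp_eq.
have sb : (size b <= n.+1)%N by rewrite size_polyN -ltnS -sD ltn_modp.
have sQD : size (Q * D) = (n + d).+2.
  have -> : Q * D = L + b by rewrite LE subrK.
  by rewrite size_polyDl // sL (leq_ltn_trans sb) // ltnS ltnS leq_addr.
have mQ : Q \is monic.
  rewrite -(monicMr _ mD).
  have -> : Q * D = L + b by rewrite LE subrK.
  rewrite monicE lead_coefDl; first by move: mL; rewrite monicE.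
  by rewrite sL (leq_ltn_trans sb) // ltnS ltnS leq_addr.
have sQ : size Q = d.+1.
  by move: sQD; rewrite size_monicM // sD; lia.
exists (lam - N * Q), b; split=> //; last first.
  rewrite -/L LE; ring.
have mNQ : N * Q \is monic by rewrite monicMl.
have sNQ : size (N * Q) = n.+1.
  by rewrite size_monicM ?monic_neq0 // sN sQ; lia.
apply/leq_sizeP=> j; rewrite leq_eqVlt coefB => /orP[/eqP<-|nj].
  move/monicP: mNQ; move/monicP: mlam; rewrite !lead_coefE sNQ slam /= => -> ->.
  exact: subrr.
by rewrite !nth_default ?subrr ?sNQ ?slam.
Qed.

Lemma parameter_identity (F : fieldType) (l dm nn dd a b u r : F) :
  l != 0 -> dd != 0 -> dm != 0 -> l * dm * nn = (l - a) * dd - b * nn ->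
  dm * (nn / dd * u - r / dm) = u - (a / l * u + b / l * (nn / dd * u) + r).
Proof.
move=> nzl nzd nzm e; apply: (mulfI nzl); apply: (mulfI nzd).
have -> : dd * (l * (dm * (nn / dd * u - r / dm))) = l * dm * nn * u - dd * l * r.
  by field; rewrite nzd nzm.
by rewrite e; field; rewrite nzd nzl.
Qed.

(** The entries of theta are the coefficients of a, those of b - b_n lam, then b_n
    for the entry y of phi and 1 for its entry r. *)
Lemma plant_parameter_exists n (D N Dm lam : {poly R}) (a b : {poly R}) :
  D != 0 -> Dm != 0 -> lam \is monic -> size lam = n.+1 ->
  (size a <= n)%N -> (size b <= n.+1)%N ->
  lam * Dm * N = (lam - a) * D - b * N ->
  exists theta : 'cV[R]_(2 * n.+1), plant_parameter D N Dm lam theta.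
Proof.
move=> nzD nzDm mlam slam sa sb e.
pose c := b - b`_n *: lam.
have sc : (size c <= n)%N.
  apply/leq_sizeP=> j; rewrite leq_eqVlt coefB coefZ => /orP[/eqP<-|nj].
    by move/monicP: mlam; rewrite lead_coefE slam /= => ->; rewrite mulr1 subrr.
  rewrite (nth_default _ (leq_trans sb nj)) [lam`_j]nth_default ?slam //.
  by rewrite mulr0 subrr.
pose th i := if (i < n)%N then a`_i else if (i < 2 * n)%N then c`_(i - n)
  else if i == (2 * n)%N then b`_n else 1.
exists (\col_i th i).
pose ph i (j : 'I_(1 + 2)) : {poly R} :=
  if (i < n)%N then (if (j == 0 :> nat)%N then 'X^i else 0)
  else if (i < 2 * n)%N then (if (j == 1 :> nat)%N then 'X^(i - n) else 0)
  else if (i == 2 * n :> nat)%N then (if (j == 1 :> nat)%N then lam else 0)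
  else (if (j == 2 :> nat)%N then lam else 0).
pose tot (j : 'I_(1 + 2)) : {poly R} :=
  if (j == 0 :> nat)%N then a else if (j == 1 :> nat)%N then b else lam.
have totE j : \sum_(i < 2 * n.+1) th i *: ph i j = tot j.
  rewrite -(big_mkord xpredT (fun i => th i *: ph i j)).
  rewrite mulnS addnC addn2 !big_nat_recr //= (@big_cat_nat _ _ _ n) ?leq_pmull //=.
  have thl i : (n <= i < 2 * n)%N -> th i = c`_(i - n).
    by move=> /andP[ni i2]; rewrite /th ltnNge ni i2.
  have phl i : (n <= i < 2 * n)%N ->
      ph i j = if (j == 1 :> nat)%N then 'X^(i - n) else 0.
    by move=> /andP[ni i2]; rewrite /ph ltnNge ni i2.
  have -> : \sum_(0 <= i < n) th i *: ph i j = if (j == 0 :> nat)%N then a else 0.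
    rewrite big_mkord; case: ifP => j0; last first.
      by rewrite big1 // => i _; rewrite /ph ltn_ord j0 scaler0.
    under eq_bigr => i _ do rewrite /th /ph ltn_ord j0.
    rewrite -poly_def; apply/polyP=> i; rewrite coef_poly; case: ltnP => // ni.
    by rewrite nth_default // (leq_trans sa).
  have -> : \sum_(n <= i < 2 * n) th i *: ph i j = if (j == 1 :> nat)%N then c else 0.
    rewrite -{1}[n]add0n big_addn mul2n -addnn addnK big_mkord.
    case: ifP => j1; last first.
      by rewrite big1 // => i _; rewrite phl ?j1 ?scaler0 //; have := ltn_ord i; lia.
    have bnd (i : 'I_n) : (n <= i + n < 2 * n)%N by have := ltn_ord i; lia.
    under eq_bigr => i _ do rewrite (thl _ (bnd i)) (phl _ (bnd i)) j1 addnK.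
    rewrite -poly_def; apply/polyP=> i; rewrite coef_poly; case: ltnP => // ni.
    by rewrite nth_default // (leq_trans sc).
  have -> : th (2 * n)%N = b`_n by rewrite /th ltnn eqxx ltnNge leq_pmull.
  have -> : th (2 * n).+1 = 1.
    by rewrite /th !ltnNge leqnSn (leq_trans _ (leqnSn _)) ?leq_pmull //= gtn_eqF.
  have -> : ph (2 * n)%N j = if (j == 1 :> nat)%N then lam else 0.
    by rewrite /ph ltnn eqxx ltnNge leq_pmull.
  have -> : ph (2 * n).+1 j = if (j == 2 :> nat)%N then lam else 0.
    by rewrite /ph !ltnNge leqnSn (leq_trans _ (leqnSn _)) ?leq_pmull //= gtn_eqF.
  rewrite scale1r /tot; case: j {phl} => [[|[|[|]]]] //= _.
  - by rewrite scaler0 !addr0.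
  - by rewrite add0r addr0 subrK.
  - by rewrite scaler0 !add0r.
have taE j : ((map_mx (@rcst R) (\col_i th i))^T *m phi_tf n.+1 lam) 0 j
    = (tot j)%:F / lam%:F.
  rewrite -totE rmorph_sum mulr_suml mxE; apply: eq_bigr => i _.
  by rewrite !mxE mulrA -mul_polyC rmorphM.
have nzlam : lam%:F != 0 :> K by rewrite tofrac_eq0 monic_neq0.
have nzDF : D%:F != 0 :> K by rewrite tofrac_eq0.
have nzDmF : Dm%:F != 0 :> K by rewrite tofrac_eq0.
move=> U Rf Y E Phi.
have -> : ((map_mx (@rcst R) (\col_i th i))^T *m Phi) 0 0
    = a%:F / lam%:F * U + b%:F / lam%:F * Y + Rf.
  rewrite /Phi mulmxA mxE big_split_ord big_ord1 /= big_ord_recr big_ord1 /=.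
  rewrite !taE col_mxEu !col_mxEd [U%:M 0 0]mxE mulr1n ![col2 _ _ _ _]mxE /tot /=.
  rewrite [lam%:F / lam%:F](mulfV nzlam) mul1r.
  by rewrite addrA.
have {}e : lam%:F * Dm%:F * N%:F = (lam%:F - a%:F) * D%:F - b%:F * N%:F :> K.
  by rewrite -!tofracM -!tofracB -tofracM e -tofracB.
rewrite /E /Y; exact: (parameter_identity U Rf nzlam nzDF nzDmF e).
Qed.

Lemma plant_exists n d (Dm lam : {poly R}) (c : R) :
  (0 < d <= n)%N -> Dm \is monic -> size Dm = d.+1 ->
  lam \is monic -> size lam = n ->
  c != 0 ->
  exists (P : siso R n) theta, plant_class d Dm lam P theta /\
    siso_tf P = 'X^(n - d)%:F / ('X^n + c%:P)%:F.
Proof.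
case: n => [|n]; first by case: d.
case: d => // d /andP[_]; rewrite ltnS => dn mDm sDm mlam slam nzc.
set D : {poly R} := 'X^(n.+1) + c%:P; set N : {poly R} := 'X^(n.+1 - d.+1).
have cXn : (size c%:P < size ('X^(n.+1) : {poly R}))%N.
  by rewrite size_polyXn size_polyC (leq_ltn_trans (leq_b1 _)).
have sD : size D = n.+2 by rewrite /D size_polyDl // size_polyXn.
have mD : D \is monic.
  by rewrite monicE lead_coefDl // -monicE monicXn.
have sN : size N = (n - d).+1 by rewrite size_polyXn subSS.
have mN : N \is monic by exact: monicXn.
have DN : coprimep D N.
  apply: coprimep_expr; rewrite coprimepX /root /D hornerD hornerXn hornerC.
  by rewrite expr0n add0r.
have eP := companion_tf mD sD (N := N).
have [|a [b [sa sb e]]] := matching mD mN mDm mlam sD sN sDm slam.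
  by rewrite subnK.
have [theta hp] :=
  plant_parameter_exists (monic_neq0 mD) (monic_neq0 mDm) mlam slam sa sb e.
have tfP : siso_tf (companion_siso n.+1 D N) = N%:F / D%:F.
  by apply: eP; rewrite sN ltnS leq_subr.
exists (companion_siso n.+1 D N), theta; split=> //.
exists D, N; split; [by split=> //; rewrite sN subSS | by [] | | exact: hp].
exact: minimal_siso DN sD tfP.
Qed.

(** For two values of c, the plants s^(n-d) / (s^n + c) would have the same
    inverse. *)
Lemma mrc_not_PIRC n d (Dm lam : {poly R}) q (G : phi_filter R n q) :
  (0 < d <= n)%N -> Dm \is monic -> size Dm = d.+1 ->
  lam \is monic -> size lam = n ->
  realizes_phi lam G -> ~ PIRC (plant_class d Dm lam) (mrc G).
Proof.
move=> hd mDm sDm mlam slam hG [Khat H].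
have inv c : c != 0 ->
    ('X^n + c%:P)%:F / ('X^(n - d))%:F =
    ctr_tf Khat 0 0 + Dm%:F * ctr_tf Khat 0 1.
  move=> nzc; have [P [theta [cP tfP]]] := plant_exists hd mDm sDm mlam slam nzc.
  have [T [_ _]] := H _ _ cP.
  case: cP => D [N [[_ mD mN _ _] eP _ hp]].
  have nzP : siso_tf P != 0.
    by rewrite eP mulf_neq0 ?invr_eq0 ?tofrac_eq0 ?monic_neq0.
  have nzDm : Dm%:F != 0 :> K by rewrite tofrac_eq0 monic_neq0.
  rewrite (closed_loop_mrc hG (monic_neq0 mDm) hp eP nzP) /closed_loop_tf => e.
  have : (siso_tf P)^-1 = ctr_tf Khat 0 0 + Dm%:F * ctr_tf Khat 0 1.
    exact: (loop_tf_inv nzDm nzP e).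
  by rewrite tfP invf_div.
have := inv 1 (oner_neq0 _); rewrite -(inv 2) ?pnatr_eq0 // => e.
have nzX : 'X^(n - d)%:F != 0 :> K by rewrite tofrac_eq0 monic_neq0 ?monicXn.
move/(mulIf (invr_neq0 nzX))/eqP: e; rewrite tofrac_eq => /eqP/addrI/polyC_inj.
by move=> e12; have := eqr_nat R 1 2; rewrite -e12 eqxx.
Qed.

(** * The parameter-independent realization *)

(** The rows select y and r in [col2 y r]; the columns inject them. *)
Local Notation ey := (delta_mx 0 0 : 'rV_2).
Local Notation er := (delta_mx 0 1 : 'rV_2).
Local Notation cy := (delta_mx 0 0 : 'cV_2).
Local Notation cr := (delta_mx 1 0 : 'cV_2).

Lemma ey_col2 (F : comNzRingType) (a b : F) :
  delta_mx 0 0 *m col2 a b = a%:M :> 'M[F]_1.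
Proof. by rewrite -rowE; apply/matrixP=> i j; rewrite !ord1 !mxE. Qed.

Lemma er_col2 (F : comNzRingType) (a b : F) :
  delta_mx 0 1 *m col2 a b = b%:M :> 'M[F]_1.
Proof. by rewrite -rowE; apply/matrixP=> i j; rewrite !ord1 !mxE. Qed.

Lemma col2E (F : comNzRingType) (a b : F) :
  col2 a b = a *: delta_mx 0 0 + b *: delta_mx 1 0.
Proof.
apply/colP=> i; rewrite !mxE; case: i => [[|[|]]] //= _.
  by rewrite mulr1 mulr0 addr0.
by rewrite mulr0 mulr1 add0r.
Qed.

Lemma residual_sum m (p f a h v b g t o : 'cV[R]_m) : g + o = p + t ->
  p + f + (h + a + (v + b)) - (0 + (g + (a + f)) + (b - t)) = o + v + h.
Proof. by move=> /colP e; apply/colP=> i; move/(_ i): e; rewrite !mxE => e; lra. Qed.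

(** The equation error theta^T phi - (u - Dm(p) y + r) as an output of the plant and
    the filter: Dm(p) y is C_P Dm(A_P) x + u because the plant has relative degree
    [(size Dm).-1] and gain one, and theta^T phi has feedthrough 1 from r. *)
Definition equation_error n q (G : phi_filter R n q) (P : siso R n)
    (Dm : {poly R}) (theta : 'cV[R]_(2 * n)) : 'rV[R]_(n + q) :=
  row_mx (sisoC P *m mxeval (sisoA P) Dm + theta^T *m phiD G *m cy *m sisoC P)
         (theta^T *m phiC G).

Section Design.
Variables (n q l : nat) (G : phi_filter R n q) (F : siso R l) (Dm : {poly R}).

Let A0 := sisoA F + sisoB F *m sisoC F.
(** The row (c, 0), where c y = C_F E x is what the change of coordinates adds to
    u = C_F z. *)
Let W : 'rV[R]_2 := sisoC F *m mxeval A0 (drop_poly 1 Dm) *m sisoB F *m ey.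

(** The filter phi fed with the reconstructed input u, and a realization of the map
    from (y, r) to u = F/(1 - F) (r - Dm y) that has the order of F. *)
Definition pirc_controller : controller R (q + l) :=
  Controller
    (block_mx (phiA G) (phiBu G *m sisoC F) 0 A0)
    (col_mx (phiB G - phiBu G *m W)
            (sisoB F *m er - mxeval A0 Dm *m sisoB F *m ey))
    (row_mx 0 (sisoC F)) (- W).

Definition pirc_coordinates (P : siso R n) : 'M[R]_(q + l, n + (q + l)) :=
  row_mx (col_mx 0 (mxdiff A0 (sisoA P) (sisoB F *m sisoC P) Dm)) 1%:M.

Lemma pirc_coordinates_unit P : col_mx (row_mx 1%:M 0) (pirc_coordinates P) \in unitmx.
Proof.
by rewrite -[col_mx _ _]/(block_mx _ _ _ _) unitmxE det_lblock !det1 mulr1 unitr1.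
Qed.

Variable k : nat.
Hypothesis Dm_size : size Dm = k.+2.
Hypothesis Dm_monic : Dm \is monic.
Hypothesis F_rel : forall i, (i < k)%N -> sisoC F *m sisoA F ^+ i *m sisoB F = 0.

Lemma F0_rel i : (i < k)%N -> sisoC F *m A0 ^+ i *m sisoB F = 0.
Proof. by move=> ik; rewrite (feedback_pow F_rel) ?F_rel // ltnW. Qed.

(** The controller solves u = F (u - Dm y + r).  Undoing the change of coordinates,
    with s y in place of y', recovers the state Z of F. *)
Lemma pirc_controller_tf :
  ctr_tf pirc_controller =
  siso_tf F *: ((ratmx er - Dm%:F *: ratmx ey) + 1 *: ctr_tf pirc_controller).
Proof.
rewrite /ctr_tf /=; set A := block_mx _ _ _ _; set B := col_mx _ _.
rewrite (transferE _ _ (resolveK A B)) map_row_mx map_mx0.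
have := resolveK A B.
rewrite -[resolve A B]vsubmxK sI_block map_col_mx mul_block_col.
set X := usubmx _; set X2 := dsubmx _; case/eq_col_mx=> _.
rewrite map_mx0 oppr0 mul0mx add0r => eX2.
rewrite mul_row_col mul0mx add0r scale1r.
pose Z := X2 - sdiff A0 Dm *m ratmx (sisoB F *m ey).
set g := ratmx er - _; set U := _ + _.
have CZ : ratmx (sisoC F) *m Z = U.
  rewrite /Z /U mulmxBr map_mxN; congr (_ - _).
  rewrite map_mxM !mulmxA (sdiff_markov F0_rel Dm_size) -map_mxM.
  by rewrite /W.
have eZ : sI A0 *m Z = ratmx (sisoB F) *m g.
  rewrite mulmxBr eX2 mulmxA sdiffP mulmxBl mul_scalar_mx map_mxB.
  rewrite -!map_mxM opprB addrA -!mulmxA subrK.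
  by rewrite /g mulmxBr !map_mxM -scalemxAr.
have eZF : sI (sisoA F) *m Z = ratmx (sisoB F) *m (g + U).
  rewrite [RHS]mulmxDr -CZ -eZ !sI_mul /A0 map_mxD mulmxDl map_mxM -mulmxA.
  by rewrite opprD addrA subrK.
have {1}<- := CZ; have -> : Z = resolve (sisoA F) (sisoB F) *m (g + U).
  by apply: (can_inj (mulKmx (sI_unit (sisoA F)))); rewrite eZF mulmxA resolveK.
by rewrite mulmxA mul_mx11 siso_tfE.
Qed.

Section Trajectory.
Variables (P : siso R n) (theta : 'cV[R]_(2 * n)).
Hypothesis P_rel : forall i, (i < k)%N -> sisoC P *m sisoA P ^+ i *m sisoB P = 0.
Hypothesis P_gain : sisoC P *m sisoA P ^+ k *m sisoB P = 1%:M.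
Hypothesis thD_r : (theta^T *m phiD G) 0 1 = 1.

Let thC := theta^T *m phiC G.
Let thD := theta^T *m phiD G.
Let E := mxdiff A0 (sisoA P) (sisoB F *m sisoC P) Dm.
Let L := equation_error G P Dm theta.

Lemma Dm_lead : Dm`_k.+1 = 1.
Proof. by move/monicP: Dm_monic; rewrite lead_coefE Dm_size. Qed.

(** In E the input u only appears in the derivative of the term of highest order,
    whose coefficient is B_F because Dm is monic. *)
Lemma pirc_shift_input : E *m sisoB P = sisoB F.
Proof.
rewrite /E /mxdiff Dm_size mulmx_suml big_ord_recr /= drop_poly_eq0 ?Dm_size //.
rewrite {2}/mxeval size_poly0 big_ord0 !mul0mx addr0 big_ord_recr /=.
rewrite big1 ?add0r => [|i _].
  rewrite -!mulmxA [sisoC P *m _]mulmxA P_gain mulmx1.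
  rewrite mxeval_drop drop_poly_eq0 ?Dm_size //.
  by rewrite /mxeval size_poly0 big_ord0 mulmx0 addr0 Dm_lead mul1mx.
by rewrite -!mulmxA [sisoC P *m _]mulmxA P_rel // !mulmx0.
Qed.

Lemma pirc_shift_output :
  sisoC F *m E = sisoC F *m mxeval A0 (drop_poly 1 Dm) *m sisoB F *m sisoC P.
Proof. by rewrite /E (mxdiff_markov F0_rel) ?Dm_size. Qed.

Lemma thD_col2 a b : thD *m col2 a b = a *: (thD *m cy) + b%:M.
Proof.
rewrite col2E mulmxDr -!scalemxAr; congr (_ + _).
have -> : thD *m cr = 1%:M by apply: mx11_eq; rewrite -colE mxE.
by rewrite scale_scalar_mx mulr1.
Qed.

(** In the derivative of z + E x, the term E B_P u = B_F u completes A_F z into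
    A0 z.  The Sylvester equation turns E A_P x into
    A0 E x - Dm(A0) B_F y + B_F C_P Dm(A_P) x, whose last term is part of B_F times
    the equation error. *)
Lemma pirc_residual (x : 'cV[R]_n) (xi : 'cV[R]_q) (z : 'cV[R]_l) (r : R)
    (C := filtered_mrc G F theta) (u := (sisoC F *m z) 0 0)
    (w := col2 ((sisoC P *m x) 0 0) r)
    (chi := pirc_coordinates P *m col_mx x (col_mx xi z)) :
  pirc_coordinates P *m col_mx (sisoA P *m x + u *: sisoB P)
      (ctrA C *m col_mx xi z + ctrB C *m w)
    - (ctrA pirc_controller *m chi + ctrB pirc_controller *m w)
  = col_mx 0 ((L *m col_mx x xi) 0 0 *: sisoB F)
  /\ u - (ctrC pirc_controller *m chi + ctrD pirc_controller *m w) 0 0 = 0.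
Proof.
have uE : sisoC F *m z = u%:M by exact: mx11_scalar.
have yE : sisoC P *m x = ((sisoC P *m x) 0 0)%:M by exact: mx11_scalar.
set y := (sisoC P *m x) 0 0 in w yE *.
have chiE : chi = col_mx xi (E *m x + z).
  by rewrite /chi mul_row_col mul1mx mul_col_mx mul0mx add_col_mx add0r.
have Ww : W *m w = sisoC F *m (E *m x).
  by rewrite mulmxA pirc_shift_output /W -!mulmxA ey_col2 yE.
have eyw : ey *m w = sisoC P *m x by rewrite ey_col2.
have erw : er *m w = r%:M by rewrite er_col2.
split; last first.
  rewrite chiE /= mul_row_col mul0mx add0r mulNmx Ww mulmxDr.
  by rewrite [sisoC F *m _ + _]addrC addrK subrr.
rewrite chiE mul_row_col mul1mx mul_col_mx mul0mx -/E /=.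
rewrite !mul_block_col !mul_col_mx !add_col_mx opp_col_mx add_col_mx add0r.
congr col_mx.
  move: Ww; generalize W => V Vw.
  rewrite mulmxBl -!mulmxA Vw !mulmxDr.
  by apply/colP=> i; rewrite !mxE; ring.
have sylv :=
  congr1 (mulmx^~ x) (mxdiffP A0 (sisoA P) (sisoB F *m sisoC P) Dm).
rewrite -/E /= [LHS]mulmxDl [RHS]mulmxDl in sylv.
have eps : (L *m col_mx x xi) 0 0 *: sisoB F
    = sisoB F *m sisoC P *m mxeval (sisoA P) Dm *m x
      + sisoB F *m (thD *m (cy *m (sisoC P *m x))) + sisoB F *m (thC *m xi).
  rewrite -mul_mx_scalar -(mx11_scalar (L *m col_mx x xi)).
  by rewrite /L /equation_error -/thC -/thD mul_row_col mulmxDl !mulmxDr !mulmxA.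
have inp : thD *m w = thD *m (cy *m (sisoC P *m x)) + r%:M.
  by rewrite thD_col2 yE mul_mx_scalar -scalemxAr.
have A0z : A0 *m z = sisoA F *m z + u *: sisoB F.
  by rewrite mulmxDl -mulmxA uE mul_mx_scalar.
rewrite eps mul0mx mulmxDr -scalemxAr pirc_shift_input !mulmxDr A0z mulmxBl.
rewrite -[_ *m thD *m w]mulmxA inp mulmxDr -[_ *m ey *m w]mulmxA eyw.
rewrite -[_ *m er *m w]mulmxA erw -[_ *m thC *m xi]mulmxA; apply: residual_sum.
by move: sylv; rewrite !mulmxA.
Qed.

End Trajectory.
End Design.

(** * The filtered controller *)

Lemma mx11_combination (F : comNzRingType) (a p : F) (m1 m2 m3 : 'M[F]_1) :
  (a%:M + p *: m1 + (m2 + p *: m3)) 0 0 = a + p * m1 0 0 + (m2 0 0 + p * m3 0 0).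
Proof. by rewrite !mxE. Qed.

Lemma output_cancel (F : comNzRingType) (a b c p : F) :
  1 - a - b * p - 1 + p * c + (a + p * (b - c)) = 0.
Proof. by ring. Qed.

(** The state matrix of the plant followed by the filter phi; its inputs are u and
    r. *)
Definition plant_filter_mx n q (G : phi_filter R n q) (P : siso R n) :=
  block_mx (sisoA P) 0 (phiB G *m cy *m sisoC P) (phiA G).

Section ZeroTf.
Variables (n q k : nat) (G : phi_filter R n q) (P : siso R n) (Dm : {poly R}).
Variable theta : 'cV[R]_(2 * n).
Hypothesis Dm_size : size Dm = k.+2.
Hypothesis Dm_monic : Dm \is monic.
Hypothesis P_rel : forall i, (i < k)%N -> sisoC P *m sisoA P ^+ i *m sisoB P = 0.
Hypothesis P_gain : sisoC P *m sisoA P ^+ k *m sisoB P = 1%:M.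
Hypothesis id_y :
  Dm%:F * siso_tf P = 1 - phi_u G theta - phi_yr G theta 0 0 * siso_tf P.
Hypothesis id_r : phi_yr G theta 0 1 = 1.

Let thC := theta^T *m phiC G.
Let thD := theta^T *m phiD G.
Let L := equation_error G P Dm theta.
Let Ae := plant_filter_mx G P.

(** The transfer function from r to theta^T phi is the constant 1, hence it is pure
    feedthrough. *)
Lemma reference_gain : thD 0 1 = 1
  /\ (ratmx thC *m resolve (phiA G) (phiB G *m cr)) 0 0 = 0.
Proof.
have e : (ratmx thC *m resolve (phiA G) (phiB G *m cr)) 0 0 = rcst (1 - thD 0 1).
  rewrite rmorphB rmorph1 -id_r [phi_yr _ _ 0 1]mxE -/thC -/thD.
  by rewrite [(ratmx thD) 0 1]mxE addrK resolve_mulr mulmxA map_delta_mx -colE mxE.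
have [/eqP] := markov0 e; rewrite subr_eq0 => /eqP h _.
by rewrite -h subrr rmorph0 in e.
Qed.

Lemma reference_zero_tf i :
  (L *m Ae ^+ i *m col_mx 0 (phiB G *m cr)) 0 0 = 0.
Proof.
suff e : (ratmx L *m resolve Ae (col_mx 0 (phiB G *m cr))) 0 0 = rcst 0.
  by have [_ ->] := markov0 e.
have -> : resolve Ae (col_mx 0 (phiB G *m cr)) =
    col_mx 0 (resolve (phiA G) (phiB G *m cr)).
  apply/esym/resolve_unique; rewrite /Ae /plant_filter_mx sI_block mul_block_col.
  rewrite !mulmx0 map_mx0 oppr0.
  by rewrite mul0mx !add0r resolveK map_col_mx map_mx0.
have [_ e] := reference_gain.
by rewrite /L /equation_error map_row_mx mul_row_col mulmx0 add0r e rmorph0.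
Qed.

(** Dm(p) y = C_P Dm(A_P) x + u. *)
Lemma plant_output_derivative :
  ratmx (sisoC P *m mxeval (sisoA P) Dm) *m resolve (sisoA P) (sisoB P)
  = (Dm%:F * siso_tf P - 1)%:M.
Proof.
rewrite map_mxM -mulmxA mxeval_resolve mulmxBr mulmxA (sdiff_markov P_rel Dm_size).
rewrite (mxeval_markov P_rel); last by rewrite size_drop_poly Dm_size subn1.
rewrite coef_drop_poly addn1 P_gain (Dm_lead Dm_size Dm_monic) scale1r map_mx1.
rewrite -scalemxAr [_ *m resolve _ _]mx11_scalar -siso_tfE scale_scalar_mx.
by rewrite -raddfB.
Qed.

(** For input u the equation error is Dm y - u + theta^T phi with r = 0, which
    vanishes by the matching identity. *)
Lemma plant_zero_tf i : (L *m Ae ^+ i *m col_mx (sisoB P) (phiBu G)) 0 0 = 0.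
Proof.
pose p := siso_tf P.
suff e : (ratmx L *m resolve Ae (col_mx (sisoB P) (phiBu G))) 0 0 = rcst 0.
  by have [_ ->] := markov0 e.
have pE : ratmx (sisoC P) *m resolve (sisoA P) (sisoB P) = p%:M.
  by rewrite /p siso_tfE -mx11_scalar.
have -> : resolve Ae (col_mx (sisoB P) (phiBu G))
    = col_mx (resolve (sisoA P) (sisoB P))
             (resolve (phiA G) (phiBu G) + p *: resolve (phiA G) (phiB G *m cy)).
  apply/esym/resolve_unique; rewrite /Ae /plant_filter_mx sI_block mul_block_col.
  rewrite map_mx0 oppr0 mul0mx addr0.
  rewrite resolveK mulmxDr -scalemxAr !resolveK map_col_mx; congr col_mx.
  rewrite [ratmx (_ *m sisoC P)]map_mxM mulNmx -mulmxA pE mul_mx_scalar.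
  by rewrite addrCA addNr addr0.
have y0 : (ratmx thC *m resolve (phiA G) (phiB G *m cy)) 0 0
    = phi_yr G theta 0 0 - rcst ((thD *m cy) 0 0).
  rewrite resolve_mulr mulmxA map_delta_mx -!colE !mxE.
  by rewrite addrK.
rewrite /L /equation_error -/thC -/thD map_row_mx mul_row_col map_mxD mulmxDl.
rewrite plant_output_derivative.
rewrite map_mxM -mulmxA pE mul_mx_scalar mulmxDr -scalemxAr.
rewrite mx11_combination -/(phi_u G theta) [(ratmx (thD *m cy)) 0 0]mxE.
rewrite rmorph0 -/p id_y.
move: y0; move: (rcst ((thD *m cy) 0 0)) => b y0; rewrite y0.
exact: output_cancel.
Qed.

Lemma equation_error_decay (x : R -> 'cV[R]_n) (xi : R -> 'cV[R]_q) (u r : R -> R) :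
  (forall V : 'rV[R]_n,
     (forall i, (V *m sisoA P ^+ i *m sisoB P) 0 0 = 0) -> V = 0) ->
  hurwitz (char_poly (phiA G)) ->
  has_velocity x (fun t => sisoA P *m x t + u t *: sisoB P) ->
  has_velocity xi (fun t => phiA G *m xi t + u t *: phiBu G
     + phiB G *m col2 ((sisoC P *m x t) 0 0) (r t)) ->
  exp_decay (fun t => (L *m col_mx (x t) (xi t)) 0 0).
Proof.
move=> ctrb stable dx dxi.
apply: (output_decay (monic_neq0 (char_poly_monic (phiA G))) stable
  (unobservable_poly ctrb plant_zero_tf) plant_zero_tf reference_zero_tf
  (u1 := u) (u2 := r)).
have := has_velocity_col dx dxi; congr has_velocity; apply/funext=> t.
rewrite mul_block_col !scale_col_mx !add_col_mx mul0mx scaler0 !addr0.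
congr col_mx; rewrite col2E mulmxDr -!scalemxAr.
have -> : (phiB G *m cy *m sisoC P) *m x t = (sisoC P *m x t) 0 0 *: (phiB G *m cy).
  by rewrite -mulmxA -mul_mx_scalar -mx11_scalar.
by apply/colP=> i; rewrite !mxE; ring.
Qed.
End ZeroTf.

(** The new coordinates keep the state of the filter phi and replace the state z of
    F by z + E x.  The only residual is B_F times the equation error. *)
Lemma filtered_mrc_PIRC n d (Dm lam : {poly R}) q (G : phi_filter R n q)
    (nNf nDf : nat) (Nf Df : {poly R}) (F : siso R nDf) :
  (0 < d <= n)%N -> Dm \is monic -> size Dm = d.+1 -> hurwitz lam ->
  realizes_phi lam G -> hidden_modes_decay lam G ->
  size Nf = nNf.+1 -> size Df = nDf.+1 ->
  siso_tf F = Nf%:F / Df%:F -> (nNf + d <= nDf)%N ->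
  PIRC (plant_class d Dm lam) (filtered_mrc G F).
Proof.
case: d => [|k] // /andP[_ kn] mDm sDm hlam hG hidden sNf sDf eF C1.
have nzDm : Dm != 0 := monic_neq0 mDm.
have F_rel : forall i, (i < k)%N -> sisoC F *m sisoA F ^+ i *m sisoB F = 0.
  apply: markov_lt; rewrite -siso_tfE eF.
  have -> : s ^+ k * (Nf%:F / Df%:F) = ('X^k * Nf)%:F / Df%:F.
    by rewrite tofracM tofracXn mulrA.
  apply: sproper_frac.
  have nzNf : Nf != 0 by rewrite -size_poly_gt0 sNf.
  by rewrite size_monicM ?monicXn // size_polyXn sNf sDf; lia.
exists (pirc_controller G F Dm) => P theta [D [N [[DN mD mN sD sN] eP _ hp]]].
have [id_y id_r] := plant_identity hG nzDm hp; rewrite -eP in id_y.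
have [P_gain P_rel] := relative_degree_gain mD mN sD sN kn eP.
have [thD_r _] := reference_gain id_r.
exists (pirc_coordinates q F Dm P); split.
- exact: pirc_coordinates_unit.
- move=> x xi r u y _ [dx yE dxi uE] chi.
  pose xf t := usubmx (xi t); pose z t := dsubmx (xi t).
  have xiE t : xi t = col_mx (xf t) (z t) by rewrite vsubmxK.
  have uz t : 0 <= t -> u t = (sisoC F *m z t) 0 0.
    by move=> t0; rewrite uE //= xiE mul_row_col mul0mx add0r mul0mx addr0.
  have stab : hurwitz (char_poly (phiA G)).
    by move=> w /hidden[/hlam|].
  have ctrb := controllable sD DN (etrans (esym (siso_tfE P)) eP).
  have dxf : has_velocity xf (fun t => phiA G *m xf t + u t *: phiBu G
     + phiB G *m col2 ((sisoC P *m x t) 0 0) (r t)).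
    have := has_velocity_mul (row_mx 1%:M 0) dxi.
    have -> : (fun t => row_mx 1%:M 0 *m xi t) = xf.
      by apply/funext=> t; rewrite xiE mul_row_col mul1mx mul0mx addr0.
    apply: has_velocity_eq => t t0; rewrite xiE mulmxDr !mulmxA.
    rewrite mul_row_block mul_row_col !mul1mx !mul0mx !addr0 mul_row_col yE // uz //.
    congr (_ + _ + _).
      by rewrite -[RHS]mul_mx_scalar -mx11_scalar mulmxA.
    by rewrite mul1mx mul0mx addr0.
  have eps := equation_error_decay sDm mDm P_rel P_gain id_y id_r ctrb stab dx dxf.
  have res (t : R) (t0 : 0 <= t) := pirc_residual sDm mDm F_rel P_rel P_gain thD_r
    (x t) (xf t) (z t) (r t).
  split=> [i|]; last first.
    apply: (@exp_decay_ext _ _ (fun=> 0)) => [t t0|].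
      by have [_] := res t t0; rewrite -xiE -yE // -uz.
    by exists 0, 1; split=> // t _; rewrite normr0 mul0r.
  have dchi := has_velocity_mul (pirc_coordinates q F Dm P) (has_velocity_col dx dxi).
  apply: (exp_decay_ext (g := fun t => col_mx 0 (sisoB F) i 0 *
     (equation_error G P Dm theta *m col_mx (x t) (xf t)) 0 0)); last exact: exp_decayZ.
  move=> t t0; have [e _] := res t t0; rewrite -xiE -yE // -uz // in e.
  have [_ dE] := dchi t i t0; rewrite derive1E dE.
  have subE (M1 M2 : 'cV[R]_(q + nDf)) : M1 i 0 - M2 i 0 = (M1 - M2) i 0.
    by rewrite !mxE.
  have scE (a : R) :
      col_mx 0 (a *: sisoB F) = a *: col_mx 0 (sisoB F) :> 'cV[R]_(q + nDf).
    by rewrite scale_col_mx scaler0.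
  by rewrite subE e scE mxE mulrC.
have e1 : Dm%:F * siso_tf P =
    1 - 1 - (ratmx er - Dm%:F *: ratmx ey : 'rV[K]_2) 0 0 * siso_tf P.
  by rewrite !map_delta_mx !mxE /= mulr1 add0r subrr sub0r mulNr opprK.
rewrite (closed_loop_tfE id_y id_r _ (filtered_mrc_tf G theta F)); last first.
  by apply/sproper_neq1/sproperM; [exact: siso_sproper | exact: sproper_tf].
rewrite (closed_loop_tfE e1 _ _ (pirc_controller_tf G sDm F_rel)) //.
  by rewrite !map_delta_mx !mxE /= mulr0 subr0.
by rewrite mulr1; apply/sproper_neq1/siso_sproper.
Qed.
End TransferFunctions.

Theorem proposition2 (R : realType) (n d : nat) (Dm lam : {poly R})
    (hd : (0 < d <= n)%N)
    (Dm_monic : Dm \is monic) (Dm_size : size Dm = d.+1)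
    (Dm_hurwitz : hurwitz Dm)
    (lam_monic : lam \is monic) (lam_size : size lam = n)
    (lam_hurwitz : hurwitz lam)
    (q : nat) (G : phi_filter R n q) (hG : realizes_phi lam G) :
  ~ PIRC (plant_class d Dm lam) (mrc G)
  /\
  (hidden_modes_decay lam G ->
   forall (nNf nDf : nat) (Nf Df : {poly R}) (F : siso R nDf),
     size Nf = nNf.+1 -> size Df = nDf.+1 -> (nNf < nDf)%N ->
     coprimep Nf Df -> hurwitz Df ->
     siso_tf F = Nf%:F / Df%:F ->
     (nNf + d <= nDf)%N ->
     hurwitz (Df - Nf) ->
     PIRC (plant_class d Dm lam) (filtered_mrc G F)).
Proof.
split; first exact: mrc_not_PIRC.
move=> hidden nNf nDf Nf Df F sNf sDf _ _ _ eF C1 _.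
exact: (filtered_mrc_PIRC hd Dm_monic Dm_size lam_hurwitz hG hidden sNf sDf eF C1).
Qed.
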